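(* For any $0<\lambda<1$ and $t\in[0,T]$, almost surely, $$|V^\lambda_t-V_t|\le N(t)\Big(1-\ln(1-e^{-1})+\mathbb E\big[\ln(\overline V^{2R}_{t,T}\vee1)\,\big|\,\mathcal F_t\big]\Big)\,[\lambda-\lambda\ln(\lambda)],$$ where $N(t)=(N+1)-\max\{i:t_i<t\}$, $\overline V^{2R}_{t,T}=\max_{t_i\in S\cap[t,T)}V^{2R}_{t_i}$, and $V^{2R}_t=\operatorname{ess\,sup}_{\tau\in\mathcal T_{t,T}(S)}\mathbb E[2R_\tau|\mathcal F_t]$ is the price of the Bermudan option with payoff process $2R$.
   Context: Setting. $(\Omega,\mathcal F,\mathbb P,\mathbb F)$ is a filtered probability space whose filtration $\mathbb F=(\mathcal F_t)_{t\ge0}$ satisfies the usual conditions; martingales are càdlàg. $T>0$, $S=\{t_0,t_1,\dots,t_N\}$ with $0=t_0<t_1<\dots<t_N<T$, and $t_{N+1}:=T$. $\mathcal T_{t,T}(S)$ is the set of $\mathbb F$-stopping times with values in $(S\cup\{T\})\cap[t,T]$. $X_{t+}$ denotes the right limit of a process $X$ at $t$; $x^+=\max(x,0)$, $x\vee y=\max(x,y)$. $P$ and $R$ are $\mathbb F$-adapted processes, $P\ge0$, with $R>P$ on $S$, $R_T=P_T$, $\max_{u\in S\cup\{T\}}\mathbb E[P_u]<\infty$ and $\max_{u\in S\cup\{T\}}\mathbb E[R_u]<\infty$. Bermudan game value. $V_t=\operatorname{ess\,sup}_{\tau\in\mathcal T_{t,T}(S)}\operatorname{ess\,inf}_{\sigma\in\mathcal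 T_{t,T}(S)}\mathbb E[P_\tau\mathbf 1_{\{\tau\le\sigma\}}+R_\sigma\mathbf 1_{\{\tau>\sigma\}}|\mathcal F_t]$; it satisfies $V_t=P_T-(M_T-M_t)+\sum_{t\le t_i<T}\{(P_{t_i}-V_{t_i+})^+-(V_{t_i+}-R_{t_i})^+\}$ with $M$ a uniformly integrable martingale. Entropy-regularised game value. For $x\ne0$, $\Psi(x)=\frac1x\ln\big(\frac{e^x-1}{x}\big)$, $\Psi(0)=\frac12$, $\Phi(x)=x\Psi(x)$. $(V^\lambda,M^\lambda)$ is the unique pair ($V^\lambda$ of class (D), $M^\lambda$ a uniformly integrable martingale started at $0$) solving $$V^\lambda_t=P_T-(M^\lambda_T-M^\lambda_t)+\sum_{t\le t_i<T}\Big\{\lambda\Phi\Big(\frac{P_{t_i}-V^\lambda_{t_i+}}\lambda\Big)-\lambda\Phi\Big(\frac{V^\lambda_{t_i+}-R_{t_i}}\lambda\Big)\Big\},\qquad t\in[0,T].$$ Conventions: $\max\emptyset:=0$ (so $N(0)=N+1$, and $\overline V^{2R}_{t,T}=0$ if $S\cap[t,T)=\emptyset$). *)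

(* Defs.v *)
From HB Require Import structures.
From mathcomp Require Export all_boot all_order all_algebra.
From mathcomp Require Export all_classical all_reals all_analysis.

Set Implicit Arguments.
Unset Strict Implicit.
Unset Printing Implicit Defensive.

Export Order.TTheory GRing.Theory Num.Theory.
Export numFieldNormedType.Exports.

#[global] Open Scope classical_set_scope.
#[global] Open Scope ring_scope.

Section regularisation.
Variable K : realType.

Definition Psi (x : K) : K :=
  if x == 0 then 2^-1 else x^-1 * ln ((expR x - 1) / x).

Definition Phi (x : K) : K := x * Psi x.

End regularisation.

(* A process is a function X : K -> Omega -> K, the first argument being time;
   only its values on [0, T] are ever constrained or used. *)
Section right_limit_and_paths.
Variables (K : realType) (Omega : Type).
Implicit Types X : K -> Omega -> K.

(* `lim` is total; for the processes below the right limit exists almost surely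
   because they are, between two consecutive dates, a cadlag martingale plus a
   quantity that does not depend on time. *)
Definition right_lim X (t : K) (w : Omega) : K := lim (X s w @[s --> t^'+]).

Definition cadlag_path (T : K) X (w : Omega) : Prop :=
  (forall t, 0 <= t < T -> X s w @[s --> t^'+] --> X t w) /\
  (forall t, 0 < t <= T -> cvg (X s w @[s --> t^'-])).

End right_limit_and_paths.

Section stochastic_basis.
Context (d : measure_display) (Omega : measurableType d) (K : realType).
Variable mu : probability Omega K.
Implicit Types (F : K -> set (set Omega)) (G : set (set Omega)).
Implicit Types (X Y Z tau : Omega -> K) (A : set (Omega -> K)).

(* On g_sigma_algebraType G the measurable sets are those of the generated
   sigma-algebra <<s G >>, which is G itself when G is a sigma-algebra. *)
Definition measurable_wrt G X : Prop :=
  measurable_fun [set: g_sigma_algebraType G] (X : g_sigma_algebraType G -> K).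

Definition filtration F : Prop :=
  [/\ forall t, 0 <= t -> sigma_algebra setT (F t),
      forall t, 0 <= t -> F t `<=` measurable &
      forall s t, 0 <= s -> s <= t -> F s `<=` F t].

Definition usual_conditions F : Prop :=
  (forall t, 0 <= t -> F t = \bigcap_(s in `]t, +oo[) F s) /\
  (forall B : set Omega, mu.-negligible B -> F 0 B).

Definition adapted F (T : K) (X : K -> Omega -> K) : Prop :=
  forall t, 0 <= t <= T -> measurable_wrt (F t) (X t).

(* Y is a version of E[X | G]. *)
Definition is_cond_exp G X Y : Prop :=
  [/\ measurable_wrt G Y, mu.-integrable setT (EFin \o Y) &
      forall B, G B -> (\int[mu]_(w in B) (Y w)%:E = \int[mu]_(w in B) (X w)%:E)%E].

(* Essential supremum and infimum of a (possibly uncountable) family of random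
   variables; not to be confused with the essential supremum of one function,
   which is a number. *)
Definition is_esssup A Z : Prop :=
  [/\ measurable_fun setT Z,
      forall X, A X -> {ae mu, forall w, X w <= Z w} &
      forall Z', measurable_fun setT Z' ->
        (forall X, A X -> {ae mu, forall w, X w <= Z' w}) ->
        {ae mu, forall w, Z w <= Z' w}].

Definition is_essinf A Z : Prop :=
  [/\ measurable_fun setT Z,
      forall X, A X -> {ae mu, forall w, Z w <= X w} &
      forall Z', measurable_fun setT Z' ->
        (forall X, A X -> {ae mu, forall w, Z' w <= X w}) ->
        {ae mu, forall w, Z' w <= Z w}].

Definition uniformly_integrable A : Prop :=
  (forall X, A X -> mu.-integrable setT (EFin \o X)) /\
  (forall e : K, 0 < e -> exists c : K, forall X, A X ->
     (\int[mu]_(w in [set w | (c <= `|X w|)%R]) (`|X w|)%:E <= e%:E)%E).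

Definition stopping_time F tau : Prop :=
  forall t, 0 <= t -> F t [set w | tau w <= t].

Definition martingale F (T : K) (M : K -> Omega -> K) : Prop :=
  [/\ adapted F T M,
      forall t, 0 <= t <= T -> mu.-integrable setT (EFin \o M t),
      forall s t, 0 <= s -> s <= t -> t <= T -> is_cond_exp (F s) (M t) (M s) &
      {ae mu, forall w, cadlag_path T M w}].

Definition ui_martingale F (T : K) (M : K -> Omega -> K) : Prop :=
  martingale F T M /\ uniformly_integrable [set M t | t in `[0, T]].

Definition class_D F (T : K) (X : K -> Omega -> K) : Prop :=
  uniformly_integrable
    [set Y | exists tau, [/\ stopping_time F tau,
                            forall w, 0 <= tau w <= T &
                            Y = fun w => X (tau w) w]].

End stochastic_basis.

(* The exercise dates t_0 < ... < t_N and t_{N+1} = T are the values ts i for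
   i <= N.+1; the other values of ts are irrelevant. *)
Section bermudan.
Context (d : measure_display) (Omega : measurableType d) (K : realType).
Variables (mu : probability Omega K) (F : K -> set (set Omega)).
Variables (N : nat) (ts : nat -> K) (T : K).
Implicit Types (P R V M X : K -> Omega -> K) (tau sigma : Omega -> K).

Definition time_grid : Prop :=
  [/\ ts 0%N = 0, ts N.+1 = T & forall i, (i <= N)%N -> ts i < ts i.+1].

Definition exercise_dates : set K := [set ts i | i in [set i | (i <= N)%N]].

(* The set T_{t,T}(S). *)
Definition bermudan_time (t : K) tau : Prop :=
  stopping_time F tau /\
  forall w, (exercise_dates `|` [set T]) (tau w) /\ t <= tau w <= T.

Definition game_payoff P R tau sigma (w : Omega) : K :=
  P (tau w) w * (tau w <= sigma w)%R%:R + R (sigma w) w * (sigma w < tau w)%R%:R.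

Definition is_game_value P R V : Prop :=
  forall t, 0 <= t <= T ->
    is_esssup mu
      [set Y | exists2 tau, bermudan_time t tau &
         is_essinf mu
           [set Z | exists2 sigma, bermudan_time t sigma &
              is_cond_exp mu (F t) (game_payoff P R tau sigma) Z] Y]
      (V t).

Definition is_bermudan_price X V : Prop :=
  forall t, 0 <= t <= T ->
    is_esssup mu
      [set Y | exists2 tau, bermudan_time t tau &
         is_cond_exp mu (F t) (fun w => X (tau w) w) Y]
      (V t).

Definition is_regularised_value (lambda : K) P R V M : Prop :=
  [/\ adapted F T V, class_D mu F T V, ui_martingale mu F T M,
      {ae mu, forall w, M 0 w = 0} &
      {ae mu, forall w, forall t, 0 <= t <= T ->
        V t w = P T w - (M T w - M t w) +
          \sum_(i < N.+1 | t <= ts i < T)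
             (lambda * Phi ((P (ts i) w - right_lim V (ts i) w) / lambda)
              - lambda * Phi ((right_lim V (ts i) w - R (ts i) w) / lambda))}].

Definition remaining_dates (t : K) : nat :=
  (N.+1 - \max_(i < N.+1 | (ts i < t)%R) i)%N.

(* The default value 0 agrees with the convention max(empty) = 0. For a non-empty
   range this is the maximum of V and 0, which makes no difference to the
   price of a nonnegative payoff. *)
Definition running_max V (t : K) (w : Omega) : K :=
  \big[Num.max/0]_(i < N.+1 | t <= ts i < T) V (ts i) w.

End bermudan.

(* Main.v *)
From HB Require Import structures.
Require Import Defs.
From mathcomp Require Import measurable_realfun ring lra zify.

(** Both values are governed by the same backward recursion up to a small
error, and an approximate recursion already contains near-optimal strategies.

Let C_i be the conditional expectation at t_i of the value U_{i+1} at t_{i+1}.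
The value of the game satisfies U_i = max (P_i, min (R_i, C_i)) (exact
recursion, [exact_recursion]), while the regularised value satisfies
U_i = C_i + f (P_i - C_i) - f (C_i - R_i) with f x = lambda Phi (x / lambda).
The function f is a smoothed positive part: x^+ - f x is even, nonnegative,
and at most (lambda - lambda ln lambda) (1 - ln (1 - 1/e) + ln m) as soon as
|x| <= m and 1 <= m ([regularised_gap]).  Hence the regularised value solves
the exact recursion up to a random error eps
([regularised_update_clamp]).  To choose m, note that f is increasing and
f (- x) = f x - x, which forces P_i <= U_i <= R_i
([regularised_update_bounds]); so 0 <= C_i <= E[R_{i+1} | F_i], and both this
bound and R_i lie below the price of 2 R at t_i.

Given any solution (U, C) of the recursion up to eps, let the holder stop the
first time that C_i <= P_i.  Whatever the seller does, U then stays, along the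
stopped game, below its conditional expectation at the next date plus eps at
each date, so that the expected payoff is at least U minus eps times the number
of dates left ([buyer_guarantee]).  The seller, stopping the first time that
R_i <= C_i, keeps the expected payoff below U plus the same error
([seller_guarantee]).  Both come from one inequality for stopped backward
recursions ([stopped_inequality]), integrated over events of the sigma-algebra
at the initial time.

With eps = 0 the two guarantees give a saddle point, at which the essential
supremum of essential infima is attained ([saddle_point_value]); this
identifies the value.  Playing the near-optimal strategies of the regularised
recursion against the saddle point then bounds the difference of the two
values by the conditional expectation of eps times the number of dates
([approx_recursion_value]), so the errors of successive dates never have to be
propagated through the recursion. *)

Set Implicit Arguments.
Unset Strict Implicit.
Unset Printing Implicit Defensive.

(** * The regularised positive part *)

Section regularised_positive_part.
Variable K : realType.
Implicit Types x y : K.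

(** The value 1 at 0 is the limit: Phi is then ln of the slope everywhere, with
no exception at 0. *)
Definition slope x : K := if x == 0 then 1 else (expR x - 1) / x.

Lemma slope_gt0 x : 0 < slope x.
Proof.
rewrite /slope; case: ifPn => // x0; case: (ltgtP x 0) x0 => // x0 _.
  by rewrite nmulr_rgt0 ?invr_lt0// subr_lt0 expR_lt1.
by rewrite pmulr_rgt0 ?invr_gt0// subr_gt0 expR_gt1.
Qed.

Lemma PhiE x : Phi x = ln (slope x).
Proof.
rewrite /Phi /Psi /slope; case: ifPn => [/eqP ->|x0]; first by rewrite ln1 mul0r.
by rewrite mulrA mulfV// mul1r.
Qed.

Lemma Phi0 : Phi 0 = 0 :> K.
Proof. by rewrite /Phi mul0r. Qed.

(** Convexity of exp on the segment from 0 to y: combine the tangent line at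
s y, evaluated at y with weight s and at 0 with weight 1 - s. *)
Lemma expR_chord (s y : K) : 0 <= s <= 1 -> expR (s * y) <= s * expR y + (1 - s).
Proof.
move=> /andP[s0 s1].
have h1 : expR (s * y) * (1 + (1 - s) * y) <= expR y.
  have -> : expR y = expR (s * y) * expR ((1 - s) * y).
    by rewrite -expRD; congr expR; ring.
  by rewrite ler_pM2l ?expR_gt0// expR_ge1Dx.
have h2 : expR (s * y) * (1 - s * y) <= 1.
  have -> : (1 : K) = expR (s * y) * expR (- (s * y)) by rewrite -expRD subrr expR0.
  by rewrite ler_pM2l ?expR_gt0// -expRD subrr expR0 expR_ge1Dx.
have h1' := ler_wpM2l s0 h1.
have s1' : 0 <= 1 - s by rewrite subr_ge0.
have := ler_wpM2l s1' h2; rewrite mulr1 => h2'.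
apply: le_trans (lerD h1' h2'); rewrite le_eqVlt; apply/orP; left; apply/eqP; ring.
Qed.

Lemma slope_homo : forall x y, x <= y -> slope x <= slope y.
Proof.
have ge1 x : 0 <= x -> 1 <= slope x.
  rewrite /slope le_eqVlt => /predU1P[<-|x0]; first by rewrite eqxx.
  by rewrite gt_eqF// ler_pdivlMr// mul1r lerBrDl expR_ge1Dx.
have le1 x : x <= 0 -> slope x <= 1.
  rewrite /slope le_eqVlt => /predU1P[->|x0]; first by rewrite eqxx.
  by rewrite lt_eqF// ler_ndivrMr// mul1r lerBrDl expR_ge1Dx.
move=> x y; rewrite le_eqVlt => /predU1P[->//|xy].
have [x0|x0] := lerP x 0; last first.
  have y0 := lt_trans x0 xy.
  rewrite /slope !gt_eqF//= ler_pdivrMr// mulrAC ler_pdivlMr//.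
  have := @expR_chord (x / y) y; rewrite mulfVK ?gt_eqF// => h.
  have {}h : expR x <= x / y * expR y + (1 - x / y).
    by apply: h; rewrite (divr_ge0 (ltW x0) (ltW y0))/= ler_pdivrMr// mul1r ltW.
  have := ler_wpM2r (ltW y0) h.
  rewrite mulrDl mulrBl (mulrAC x) -!mulrA mulVf ?gt_eqF// mulr1 mul1r; lra.
have [y0|y0] := lerP 0 y; first exact: le_trans (le1 _ x0) (ge1 _ y0).
have {}x0 := lt_trans xy y0.
rewrite /slope !lt_eqF//= ler_ndivrMr// mulrAC ler_ndivrMr//.
have := @expR_chord (y / x) x; rewrite mulfVK ?lt_eqF// => h.
have {}h : expR y <= y / x * expR x + (1 - y / x).
  by apply: h; rewrite mulr_le0 ?invr_le0 ?(ltW y0) ?(ltW x0)//= ler_ndivrMr// mul1r ltW.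
have := ler_wnM2r (ltW x0) h.
rewrite mulrDl mulrBl (mulrAC y) -!mulrA mulVf ?lt_eqF// mulr1 mul1r; lra.
Qed.

Lemma Phi_homo : forall x y, x <= y -> Phi x <= Phi y.
Proof. by move=> x y xy; rewrite !PhiE ler_ln ?posrE ?slope_gt0// slope_homo. Qed.

(** The symmetry behind everything below: (e^-x - 1) / -x = e^-x (e^x - 1) / x,
so Phi x - x / 2 is even, as is x^+ - x / 2. *)
Lemma PhiN x : Phi (- x) = Phi x - x.
Proof.
have [->|x0] := eqVneq x 0; first by rewrite oppr0 addr0.
rewrite !PhiE -{3}(expRK x) -ln_div ?posrE ?expR_gt0 ?slope_gt0//.
congr ln; rewrite /slope oppr_eq0 (negbTE x0) expRN.
by field; rewrite x0 gt_eqF ?expR_gt0.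
Qed.

Let a : K := - ln (1 - expR (-1)).

Lemma Phi_gap_even x : Num.max x 0 - Phi x = - Phi (- `|x|).
Proof.
have [x0|x0] := leP 0 x; last by rewrite ltr0_norm ?opprK ?sub0r//.
rewrite ger0_norm// PhiN; lra.
Qed.

Lemma Phi_le_posr x : Phi x <= Num.max x 0.
Proof.
by rewrite -subr_ge0 Phi_gap_even oppr_ge0 -Phi0 Phi_homo// oppr_le0.
Qed.

(** By evenness the gap is - ln (slope (- |x|)).  For |x| <= 1 the slope is at
least its value at -1, which is 1 - 1/e; for |x| >= 1 it is
(1 - e^-|x|) / |x|, at least (1 - 1/e) / |x|. *)
Lemma Phi_gap_le x : Num.max x 0 - Phi x <= a + ln (Num.max `|x| 1).
Proof.
rewrite Phi_gap_even /a -[leRHS]opprK lerN2 opprD opprK.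
have [x1|x1] := lerP `|x| 1.
  rewrite ln1 subr0 PhiE ler_ln ?posrE ?slope_gt0//.
  have <- : slope (-1) = 1 - expR (-1).
    by rewrite /slope oppr_eq0 oner_eq0 invrN1 mulrN1 opprB.
  by apply: slope_homo; rewrite lerN2.
have x0 := lt_trans ltr01 x1.
rewrite PhiE -ln_div ?posrE// ler_ln ?posrE ?divr_gt0 ?slope_gt0//.
rewrite /slope oppr_eq0 gt_eqF// invrN mulrN -mulNr opprB ler_pM2r ?invr_gt0//.
by rewrite lerD2l lerN2 ler_expR lerN2 ltW.
Qed.

Variable lambda : K.
Hypotheses (lambda_gt0 : 0 < lambda) (lambda_lt1 : lambda < 1).

Let f x := lambda * Phi (x / lambda).
Definition regularisation_rate (m : K) : K :=
  (lambda - lambda * ln lambda) * (1 - ln (1 - expR (-1)) + ln m).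

(** Rescaling by lambda turns ln (|x| / lambda) into ln |x| - ln lambda; the
product form leaves room because - ln lambda, ln m and
- ln (1 - 1/e) are nonnegative. *)
Lemma regularised_gap x (m : K) : 1 <= m -> `|x| <= m ->
  0 <= Num.max x 0 - f x <= regularisation_rate m.
Proof.
move=> m1 xm.
have -> : Num.max x 0 - f x = lambda * (Num.max (x / lambda) 0 - Phi (x / lambda)).
  rewrite mulrBr; congr (_ - _); rewrite maxr_pMr ?ltW// mulr0.
  by rewrite mulrC mulfVK ?gt_eqF.
apply/andP; split.
  by rewrite pmulr_rge0// subr_ge0 Phi_le_posr.
have l1 : ln lambda <= 0 by rewrite ln_le0// ltW.
have m0 : 0 <= ln m by rewrite ln_ge0.
have a0 : 0 <= a.
  by rewrite /a oppr_ge0 ln_le0// gerBl expR_ge0.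
have h : ln (Num.max `|x / lambda| 1) <= ln m - ln lambda.
  have m_gt0 : 0 < m by exact: lt_le_trans m1.
  have M0 : 0 < Num.max `|x / lambda| 1 by rewrite lt_max ltr01 orbT.
  rewrite -ln_div ?posrE// ler_ln ?posrE ?divr_gt0//.
  rewrite ge_max normrM (gtr0_norm (_ : 0 < lambda^-1)) ?invr_gt0//.
  rewrite ler_pM2r ?invr_gt0// xm/= ler_pdivlMr// mul1r.
  by rewrite (le_trans (ltW lambda_lt1)).
apply: (@le_trans _ _ (lambda * (a + (ln m - ln lambda)))).
  rewrite ler_pM2l//; apply: le_trans (Phi_gap_le _) _; exact: lerD.
rewrite /regularisation_rate -/a.
have p : 0 <= - ln lambda * (a + ln m) by rewrite mulr_ge0 ?oppr_ge0 ?addr_ge0.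
have {p} := ler_wpM2l (ltW lambda_gt0) p; rewrite mulr0 => p.
rewrite -subr_ge0; apply: le_trans p _; rewrite -subr_ge0.
apply: (le_trans (ltW lambda_gt0)); rewrite le_eqVlt; apply/orP; left.
by apply/eqP; rewrite /a; ring.
Qed.

(** Since f (p - c) = f (c - p) - (c - p), the update equals
p + (f (c - p) - f (c - r)), and likewise r + (f (p - c) - f (r - c)); f is
monotone. *)
Lemma regularised_update_bounds (p r c : K) : p <= r ->
  p <= c + (f (p - c) - f (c - r)) <= r.
Proof.
move=> pr.
have fN x : f (- x) = f x - x.
  by rewrite /f mulNr PhiN mulrBr [_ * (x / _)]mulrC mulfVK// gt_eqF.
have fh x y : x <= y -> f x <= f y.
  by move=> xy; rewrite /f ler_pM2l// Phi_homo// ler_pM2r ?invr_gt0.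
apply/andP; split.
  rewrite -(opprB c p) fN; have : f (c - r) <= f (c - p) by apply: fh; lra.
  lra.
rewrite -(opprB r c) fN; have : f (p - c) <= f (r - c) by apply: fh; lra.
lra.
Qed.

(** For p <= r this is c + (p - c)^+ - (c - r)^+, the update of the exact
recursion. *)
Definition clamp (p r c : K) : K := Num.max p (Num.min r c).

(** The two gaps enter with opposite signs, so that the error is the larger
gap rather than their sum. *)
Lemma regularised_update_clamp (p r c m : K) : p <= r -> 1 <= m ->
  `|p - c| <= m -> `|c - r| <= m ->
  `|c + (f (p - c) - f (c - r)) - clamp p r c| <= regularisation_rate m.
Proof.
move=> pr m1 pc cr.
have /andP[h1 h2] := regularised_gap m1 pc.
have /andP[h3 h4] := regularised_gap m1 cr.
have -> : clamp p r c = c + (Num.max (p - c) 0 - Num.max (c - r) 0).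
  rewrite /clamp; have [rc|rc] := leP r c.
    rewrite (max_r pr) [Num.max (p - c) 0]max_r; last by rewrite subr_le0 (le_trans pr).
    by rewrite [Num.max (c - r) 0]max_l ?subr_ge0//; lra.
  rewrite [Num.max (c - r) 0]max_r; last by rewrite subr_le0 ltW.
  by have [pc'|pc'] := leP (p - c) 0; have [?|?] := leP p c; lra.
by rewrite ler_norml; apply/andP; split; lra.
Qed.

Lemma regularisation_rate_ge0 (m : K) : 1 <= m -> 0 <= regularisation_rate m.
Proof.
move=> m1; have m0 : `|(0 : K)| <= m by rewrite normr0 (le_trans _ m1).
by have /andP[h /(le_trans h)] := regularised_gap m1 m0.
Qed.

End regularised_positive_part.

(** * Integrable random variables and conditional expectations *)

Section integrable_random_variables.
Context (d : measure_display) (Omega : measurableType d) (K : realType).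
Variable mu : probability Omega K.
Implicit Types (X Y : Omega -> K) (B : set Omega).

Definition L1 X := mu.-integrable setT (EFin \o X).

Lemma L1_measurable X : L1 X -> measurable_fun setT X.
Proof. by move=> /measurable_int /measurable_EFinP. Qed.

Lemma L1S X B : measurable B -> L1 X -> mu.-integrable B (EFin \o X).
Proof. by move=> mB; apply: integrableS. Qed.

Lemma L1_cst (c : K) : L1 (fun=> c).
Proof. exact: finite_measure_integrable_cst. Qed.

Lemma L1D X Y : L1 X -> L1 Y -> L1 (fun w => X w + Y w).
Proof. by move=> iX iY; apply: (integrableD _ iX iY). Qed.

Lemma L1B X Y : L1 X -> L1 Y -> L1 (fun w => X w - Y w).
Proof. by move=> iX iY; apply: (integrableB _ iX iY). Qed.

Lemma L1Z (c : K) X : L1 X -> L1 (fun w => c * X w).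
Proof. by move=> iX; apply: (integrableZl measurableT c iX). Qed.

Lemma L1_norm X : L1 X -> L1 (fun w => `|X w|).
Proof. by move=> iX; apply: integrable_norm. Qed.

Lemma le_L1 X Y : measurable_fun setT X -> L1 Y -> (forall w, `|X w| <= Y w) -> L1 X.
Proof.
move=> mX iY XY; apply: le_integrable iY => //; first exact/measurable_EFinP.
by move=> w _; rewrite /= lee_fin (le_trans (XY w))// ler_norm.
Qed.

Lemma L1_max X Y : L1 X -> L1 Y -> L1 (fun w => Num.max (X w) (Y w)).
Proof.
move=> iX iY; apply: (@le_L1 _ (fun w => `|X w| + `|Y w|)).
- by apply: measurable_maxr; exact: L1_measurable.
- exact/L1D/L1_norm/iY/L1_norm.
- by move=> w; have [_|_] := leP (X w) (Y w); rewrite ?lerDr ?lerDl.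
Qed.

Lemma L1_min X Y : L1 X -> L1 Y -> L1 (fun w => Num.min (X w) (Y w)).
Proof.
move=> iX iY; apply: (@le_L1 _ (fun w => `|X w| + `|Y w|)).
- by apply: measurable_minr; exact: L1_measurable.
- exact/L1D/L1_norm/iY/L1_norm.
- by move=> w; have [_|_] := leP (X w) (Y w); rewrite ?lerDr ?lerDl.
Qed.

Lemma L1_sum (I : Type) (r : seq I) (X : I -> Omega -> K) :
  (forall i, L1 (X i)) -> L1 (fun w => \sum_(i <- r) X i w).
Proof.
move=> iX; elim: r => [|i r ih].
  by under eq_fun do rewrite big_nil; exact: L1_cst.
by under eq_fun do rewrite big_cons; exact: L1D.
Qed.

Lemma ae_le_Rintegral X Y B : measurable B -> L1 X -> L1 Y ->
  {ae mu, forall w, B w -> X w <= Y w} ->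
  \int[mu]_(w in B) X w <= \int[mu]_(w in B) Y w.
Proof.
move=> mB iX iY XY; have iM := L1_max iX iY.
apply: (@le_trans _ _ (\int[mu]_(w in B) Num.max (X w) (Y w))).
  by apply: le_Rintegral; try exact: L1S; move=> // w _; rewrite le_max lexx.
rewrite le_eqVlt; apply/orP; left; apply/eqP; congr fine.
apply: ae_eq_integral => //.
- by apply: measurable_funTS; apply: measurable_int iM.
- by apply: measurable_funTS; apply: measurable_int iY.
- by apply: filterS XY => w /= XY Bw; rewrite max_r// XY.
Qed.

Lemma ae_eq_Rintegral X Y B : measurable B -> L1 X -> L1 Y ->
  {ae mu, forall w, X w = Y w} ->
  \int[mu]_(w in B) X w = \int[mu]_(w in B) Y w.
Proof.
move=> mB iX iY XY; apply/eqP; rewrite eq_le.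
by apply/andP; split; apply: ae_le_Rintegral => //; apply: filterS XY => w ->.
Qed.

Lemma L1_mulb X (b : Omega -> bool) : L1 X -> measurable_fun setT b ->
  L1 (fun w => X w * (b w)%:R).
Proof.
move=> iX mb; apply: (@le_L1 _ (fun w => `|X w|)); last 2 first.
- exact: L1_norm.
- by move=> w; case: (b w); rewrite ?mulr1// mulr0 normr0.
rewrite (_ : (fun _ => _) = fun w => if b w then X w else 0).
  by apply: measurable_fun_ifT => //; exact: L1_measurable iX.
by apply/funext => w; case: (b w); rewrite ?mulr1// mulr0.
Qed.

Lemma Rintegral_split X B D : measurable B -> measurable D -> L1 X ->
  \int[mu]_(w in B) X w =
  \int[mu]_(w in B `&` D) X w + \int[mu]_(w in B `&` ~` D) X w.
Proof.
move=> mB mD iX; have mC := measurableC mD.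
rewrite -Rintegral_setU -?setIUr ?setUv ?setIT//.
- exact: measurableI.
- exact: measurableI.
- exact: L1S.
- apply/disj_setPS => w [[_ Dw] [_ nDw]]; exact: nDw.
Qed.

Lemma L1_N X : L1 X -> L1 (fun w => - X w).
Proof.
move=> iX; have := L1Z (-1) iX; congr L1; apply/funext => w; exact: mulN1r.
Qed.

Lemma Rintegral_N X B : measurable B -> L1 X ->
  \int[mu]_(w in B) (- X w) = - \int[mu]_(w in B) X w.
Proof.
move=> mB iX; rewrite -mulN1r -RintegralZl//; last exact: L1S.
by apply: eq_Rintegral => w _; rewrite mulN1r.
Qed.

Lemma L1_of_expectation X : measurable_fun setT X -> {ae mu, forall w, 0 <= X w} ->
  ('E_mu[X] < +oo)%E -> L1 X.
Proof.
move=> mX X0; rewrite unlock => h; apply/integrableP; split; first exact/measurable_EFinP.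
rewrite (_ : \int[mu]_w `|(EFin \o X) w| = \int[mu]_w (X w)%:E)%E//.
apply: ae_eq_integral => //.
- by apply: measurableT_comp => //; exact/measurable_EFinP.
- exact/measurable_EFinP.
- by apply: filterS X0 => w X0 _ /=; rewrite ger0_norm.
Qed.

Lemma measurable_bigmaxr (I : Type) (r : seq I) (p : pred I) (f : I -> Omega -> K) :
  (forall i, p i -> measurable_fun setT (f i)) ->
  measurable_fun setT (fun w => \big[Num.max/0]_(i <- r | p i) f i w).
Proof.
move=> mf; elim: r => [|i r ih].
  by under eq_fun do rewrite big_nil; exact: measurable_cst.
under eq_fun do rewrite big_cons.
by have [pi|//] := boolP (p i); apply: measurable_maxr => //; exact: mf.
Qed.

Section sub_sigma_algebra.
Variable G : set (set Omega).
Hypotheses (sG : sigma_algebra setT G) (Gm : G `<=` measurable).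

Lemma measurable_wrtP X :
  measurable_wrt G X <-> forall A, measurable A -> G (X @^-1` A).
Proof.
have E : <<s G >> = G by exact: sigma_algebra_id.
split=> [mX A mA|mX _ A mA].
  by have := mX measurableT A mA; rewrite setTI /measurable/= E.
by rewrite setTI /measurable/= E; exact: mX.
Qed.

Lemma measurable_wrt_measurable X : measurable_wrt G X -> measurable_fun setT X.
Proof. by move=> /measurable_wrtP mX _ A mA; rewrite setTI; exact/Gm/mX. Qed.

(** The identity, as a map to Omega with the coarser sigma-algebra, transports
mu to the restriction of mu to G. *)
Lemma measurable_sub_id :
  measurable_fun setT (id : Omega -> g_sigma_algebraType G).
Proof.
move=> _ A; rewrite /measurable/= sigma_algebra_id// => GA.
by rewrite setTI; exact: Gm.
Qed.

Lemma sub_sigma_algebra_ltr X Y : measurable_wrt G X -> measurable_wrt G Y ->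
  G [set w | X w < Y w].
Proof.
move=> mX mY; have := measurable_fun_ltr mX mY.
move=> /(_ measurableT [set true]) /(_ I); rewrite setTI /measurable/=.
by rewrite sigma_algebra_id.
Qed.

(** The event where Y < X belongs to G, and X - Y is nonnegative on it with
nonpositive integral. *)
Lemma ae_le_sub_sigma_algebra X Y : measurable_wrt G X -> measurable_wrt G Y ->
  L1 X -> L1 Y ->
  (forall B, G B -> \int[mu]_(w in B) X w <= \int[mu]_(w in B) Y w) ->
  {ae mu, forall w, X w <= Y w}.
Proof.
move=> mX mY iX iY XY; pose D := [set w | Y w < X w].
have GD : G D by exact: sub_sigma_algebra_ltr.
have mD : measurable D by exact: Gm.
have iZ := L1B iX iY.
have Z0 : (\int[mu]_(w in D) `|(X w - Y w)%:E| = 0)%E.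
  have : \int[mu]_(w in D) (X w - Y w) <= 0.
    by rewrite RintegralB ?subr_le0 ?XY//; exact: L1S.
  rewrite le_eqVlt => /orP[/eqP h|]; last first.
    by rewrite ltNge Rintegral_ge0// => w; rewrite subr_ge0 => /ltW.
  under eq_integral => w wD.
    rewrite gee0_abs; last by rewrite lee_fin subr_ge0 ltW//; exact: set_mem wD.
    over.
  by rewrite -[LHS]fineK; [rewrite -/(Rintegral _ _ _) h|exact/integrable_fin_num/L1S].
have /(ae_eq_integral_abs mu mD) [h _] :
    measurable_fun D (fun w => (X w - Y w)%:E).
  exact/measurable_funTS/measurable_EFinP/L1_measurable.
have := h Z0; apply: filterS => w /= XYw.
by rewrite leNgt; apply/negP => YX; case: (XYw YX) => /eqP; rewrite subr_eq0 gt_eqF.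
Qed.

Lemma is_cond_expP X Y : measurable_wrt G Y -> L1 X -> L1 Y ->
  (forall B, G B -> \int[mu]_(w in B) Y w = \int[mu]_(w in B) X w) ->
  is_cond_exp mu G X Y.
Proof.
move=> mY iX iY h; split => // B GB; have mB := Gm GB.
rewrite -[LHS]fineK; last by apply/integrable_fin_num => //; exact: (L1S mB iY).
rewrite -[RHS]fineK; last by apply/integrable_fin_num => //; exact: (L1S mB iX).
by have := h _ GB; rewrite /Rintegral => ->.
Qed.

Lemma cond_exp_Rintegral X Y B : is_cond_exp mu G X Y -> G B ->
  \int[mu]_(w in B) Y w = \int[mu]_(w in B) X w.
Proof. by move=> [_ _ h] GB; rewrite /Rintegral h. Qed.

Section existence.
Variable X : Omega -> K.
Hypothesis iX : L1 X.

(** The indefinite integral of X, seen as a charge on G only: its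
Radon-Nikodym derivative with respect to the restriction of mu to G is
G-measurable, hence a conditional expectation. *)
Definition density_charge (A : set (g_sigma_algebraType G)) : \bar K :=
  induced_charge iX A.

Let measurable_of_sub (A : set (g_sigma_algebraType G)) :
  measurable A -> measurable (A : set Omega).
Proof. by move=> mA; rewrite -[A]setTI; exact: measurable_sub_id. Qed.

Let density_charge0 : density_charge set0 = 0%E.
Proof. exact: integral_set0. Qed.

Let density_charge_fin A : measurable A -> density_charge A \is a fin_num.
Proof. by move=> /measurable_of_sub mA; exact/integrable_fin_num/L1S. Qed.

Let density_charge_additive : semi_sigma_additive density_charge.
Proof.
move=> A mA tA mUA; apply: (@charge_semi_sigma_additive _ _ _
    (induced_charge iX : {charge set Omega -> \bar K})) => //.
- by move=> n; exact: measurable_of_sub.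
- exact: measurable_of_sub.
Qed.

HB.instance Definition _ := isCharge.Build _ _ _ density_charge
  density_charge0 density_charge_fin density_charge_additive.

Lemma cond_exp_exists : exists Y, is_cond_exp mu G X Y.
Proof.
pose idm : {mfun Omega >-> g_sigma_algebraType G} :=
  HB.pack (id : Omega -> g_sigma_algebraType G)
    (isMeasurableFun.Build _ _ _ _ _ measurable_sub_id).
pose muG := distribution mu idm.
have dom : density_charge `<< muG.
  apply/null_content_dominatesP => A mA muA.
  have : (\int[mu]_(w in A) (X w)%:E = 0)%E.
    apply: null_set_integral => //; first exact: measurable_of_sub.
    by apply: measurable_funTS; exact: measurable_int iX.
  by [].
pose Y0 := Radon_Nikodym density_charge muG.
have iY0 : muG.-integrable setT Y0 by exact: Radon_Nikodym_integrable.
have finY0 w : Y0 w \is a fin_num by exact: Radon_Nikodym_fin_num.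
pose Y (w : Omega) : K := fine (Y0 w).
have YE w : (Y w)%:E = Y0 w by rewrite fineK.
have mY0 : measurable_fun setT Y0 by exact: measurable_int iY0.
have mY : measurable_wrt G Y.
  by apply/measurable_EFinP; rewrite (_ : _ \o _ = Y0)//; apply/funext.
have iY : L1 Y.
  apply/integrableP; split.
    by apply/measurable_EFinP; exact: measurable_wrt_measurable.
  move/integrableP : iY0 => [_]; apply: le_lt_trans.
  rewrite ge0_integral_pushforward//; last exact: measurableT_comp.
  by rewrite le_eqVlt; apply/orP; left; apply/eqP; apply: eq_integral => w _; congr abse; exact: YE.
exists Y; split => // B GB.
have mB : measurable (B : set (g_sigma_algebraType G)).
  by rewrite /measurable/= sigma_algebra_id.
transitivity (density_charge B) => //.
rewrite (Radon_Nikodym_integral dom mB) integral_pushforward//.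
  by apply: eq_integral => w _; rewrite YE.
apply: eq_integrable (L1S (measurable_of_sub mB) iY).
  exact: measurable_of_sub mB.
by move=> w _; exact: YE.
Qed.

End existence.
End sub_sigma_algebra.
End integrable_random_variables.

Section sub_sigma_algebra_closure.
Context (Omega : pointedType).
Variable G : set (set Omega).
Hypothesis sG : sigma_algebra setT G.

Let E A : G A = measurable (A : set (g_sigma_algebraType G)).
Proof. by rewrite /measurable/= sigma_algebra_id. Qed.

Lemma salgebra_setT : G setT. Proof. by rewrite E. Qed.
Lemma salgebra_set0 : G set0. Proof. by rewrite E. Qed.
Lemma salgebra_setC A : G A -> G (~` A).
Proof. rewrite !E; exact: measurableC. Qed.
Lemma salgebra_setI A B : G A -> G B -> G (A `&` B).
Proof. rewrite !E; exact: measurableI. Qed.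
Lemma salgebra_setU A B : G A -> G B -> G (A `|` B).
Proof. rewrite !E; exact: measurableU. Qed.

End sub_sigma_algebra_closure.

Section more_conditional_expectations.
Context (d : measure_display) (Omega : measurableType d) (K : realType).
Variable mu : probability Omega K.

Lemma L1_of_cond_exp G (X Y : Omega -> K) : sigma_algebra setT G ->
  measurable_fun setT X -> (forall w, 0 <= X w) -> is_cond_exp mu G X Y -> L1 mu X.
Proof.
move=> sG mX X0 [_ iY /(_ setT (salgebra_setT sG)) e].
apply/integrableP; split; first exact/measurable_EFinP.
rewrite (_ : \int[mu]_w `|(EFin \o X) w| = \int[mu]_w (X w)%:E)%E.
  by rewrite -e ltey_eq; apply/orP; left; exact: integrable_fin_num.
by apply: eq_integral => w _ /=; rewrite ger0_norm.
Qed.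

Lemma cond_exp_affine G (X Y : Omega -> K) (a b : K) :
  sigma_algebra setT G -> G `<=` measurable -> L1 mu X -> is_cond_exp mu G X Y ->
  is_cond_exp mu G (fun w => a * (b + X w)) (fun w => a * (b + Y w)).
Proof.
move=> sG Gm iX cY; have [mY iY _] := cY.
apply: (is_cond_expP Gm).
- apply: measurable_funM; first exact: measurable_cst.
  by apply: measurable_funD => //; exact: measurable_cst.
- by apply/L1Z/L1D => //; exact: L1_cst.
- by apply/L1Z/L1D => //; exact: L1_cst.
- move=> B GB; have mB := Gm _ GB.
  have ib := L1_cst mu b.
  rewrite !RintegralZl//; [|exact/L1S/L1D..].
  rewrite !RintegralD//; [|exact: L1S..].
  by rewrite (cond_exp_Rintegral cY GB).
Qed.

End more_conditional_expectations.

(** * Exercise times on the grid *)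

Section exercise_grid.
Context (d : measure_display) (Omega : measurableType d) (K : realType).
Variables (mu : probability Omega K) (F : K -> set (set Omega)).
Hypothesis F_filtration : filtration F.
Variables (N : nat) (ts : nat -> K) (T : K).
Hypothesis ts_grid : time_grid N ts T.
Implicit Types (X Y : Omega -> K) (P R : K -> Omega -> K) (tau sigma : Omega -> K).

Lemma grid_lt i j : (i < j <= N.+1)%N -> ts i < ts j.
Proof.
have [_ _ step] := ts_grid.
move=> /andP[]; elim: j => // j ih; rewrite ltnS => ij jN.
apply: le_lt_trans (step j jN).
by move: ij; rewrite leq_eqVlt => /predU1P[->//|ij]; apply/ltW/ih => //; exact: ltnW.
Qed.

Lemma grid_le i j : (i <= j <= N.+1)%N -> ts i <= ts j.
Proof.
move=> /andP[]; rewrite leq_eqVlt => /predU1P[->//|ij jN].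
by apply/ltW/grid_lt; rewrite ij.
Qed.

Lemma grid_lt_inv i j : (i <= N.+1)%N -> ts i < ts j -> (i < j)%N.
Proof.
by move=> iN; apply: contraTT; rewrite -leqNgt -leNgt => ji; apply: grid_le; rewrite ji.
Qed.

Lemma grid_last : ts N.+1 = T. Proof. by have [] := ts_grid. Qed.

Lemma grid_ge0 i : (i <= N.+1)%N -> 0 <= ts i.
Proof. by have [<- _ _] := ts_grid => iN; apply: grid_le. Qed.

Lemma grid_leT i : (i <= N.+1)%N -> ts i <= T.
Proof. by move=> iN; rewrite -grid_last; apply: grid_le; rewrite iN/=. Qed.

Lemma grid_ltT i : (i <= N)%N -> ts i < T.
Proof. by move=> iN; rewrite -grid_last; apply: grid_lt; rewrite ltnS iN/=. Qed.

Lemma filtration_sigma i : (i <= N.+1)%N -> sigma_algebra setT (F (ts i)).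
Proof. by move=> /grid_ge0; have [h _ _] := F_filtration; exact: h. Qed.

Lemma filtration_measurable i : (i <= N.+1)%N -> F (ts i) `<=` measurable.
Proof. by move=> /grid_ge0; have [_ h _] := F_filtration; exact: h. Qed.

Lemma filtration_homo s t : 0 <= s -> s <= t -> F s `<=` F t.
Proof. by have [_ _ h] := F_filtration; exact: h. Qed.

Lemma filtration_grid i j : (i <= j <= N.+1)%N -> F (ts i) `<=` F (ts j).
Proof.
move=> ij; apply: filtration_homo; last exact: grid_le.
by apply: grid_ge0; case/andP: ij => /leq_trans h /h.
Qed.

Lemma stopping_cst (c : K) : stopping_time F (fun=> c).
Proof.
move=> s s0; have [sF _ _] := F_filtration.
have [h|h] := leP c s.
  by rewrite (_ : [set w | _] = setT);
    [exact: salgebra_setT (sF _ s0)|apply/seteqP; split].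
by rewrite (_ : [set w | _] = set0);
  [exact: salgebra_set0 (sF _ s0)|apply/seteqP; split].
Qed.

Definition grid_valued tau := forall w, exists2 i, (i <= N.+1)%N & tau w = ts i.

Lemma bermudan_grid_valued t tau : bermudan_time F N ts T t tau -> grid_valued tau.
Proof.
move=> [_ h] w; have [[[i /= iN <-]|->] _] := h w.
  by exists i => //; exact: leqW.
by exists N.+1 => //; rewrite grid_last.
Qed.

Lemma bermudan_ge t tau w : bermudan_time F N ts T t tau -> t <= tau w.
Proof. by move=> [_ /(_ w)[_ /andP[]]]. Qed.

Lemma bermudan_stopping t tau : bermudan_time F N ts T t tau -> stopping_time F tau.
Proof. by case. Qed.

Lemma bermudan_le s t tau : s <= t ->
  bermudan_time F N ts T t tau -> bermudan_time F N ts T s tau.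
Proof.
move=> st [h1 h2]; split => // w; have [h3 /andP[h4 h5]] := h2 w.
by split => //; rewrite h5 (le_trans st).
Qed.

Lemma stopping_gt tau i : (i <= N.+1)%N -> stopping_time F tau ->
  F (ts i) [set w | ts i < tau w].
Proof.
move=> iN /(_ _ (grid_ge0 iN)) /(salgebra_setC (filtration_sigma iN)).
by congr (F _ _); apply/seteqP; split => w /=; rewrite ltNge => /negP.
Qed.

Lemma stopping_min tau sigma : stopping_time F tau -> stopping_time F sigma ->
  stopping_time F (fun w => Num.min (tau w) (sigma w)).
Proof.
move=> h1 h2 t t0; have [sF _ _] := F_filtration.
have := salgebra_setU (sF t t0) (h1 t t0) (h2 t t0); congr (F _ _).
by apply/seteqP; split => w /=; rewrite ge_min => /orP.
Qed.

Lemma grid_valued_min tau sigma : grid_valued tau -> grid_valued sigma ->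
  grid_valued (fun w => Num.min (tau w) (sigma w)).
Proof.
by move=> ht hs w; have [_|_] := leP (tau w) (sigma w).
Qed.

Lemma stopping_measurable tau : grid_valued tau -> stopping_time F tau ->
  measurable_fun setT tau.
Proof.
move=> ht hs; apply: (measurability _ (RGenOInfty.measurableE K)).
move=> _ [_ [x ->] <-]; rewrite setTI.
have [_ Fm _] := F_filtration.
have [x0|x0] := leP 0 x.
  have := measurableC (Fm _ x0 _ (hs x x0)); congr measurable.
  by apply/seteqP; split => w /=; rewrite in_itv/= andbT ltNge => /negP.
rewrite (_ : _ @^-1` _ = setT)//; apply/seteqP; split => // w _ /=.
rewrite in_itv/= andbT; have [i iN ->] := ht w.
exact: lt_le_trans x0 (grid_ge0 iN).
Qed.

Lemma L1_stopped (X : K -> Omega -> K) tau :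
  (forall i, (i <= N.+1)%N -> L1 mu (X (ts i))) ->
  grid_valued tau -> measurable_fun setT tau -> L1 mu (fun w => X (tau w) w).
Proof.
move=> iX ht mt.
have -> : (fun w => X (tau w) w) =
    fun w => \sum_(i < N.+2) X (ts i) w * (tau w == ts i)%:R.
  apply/funext => w; have [i iN ti] := ht w.
  rewrite (bigD1 (Ordinal (iN : (i < N.+2)%N)))//= ti eqxx mulr1 big1 ?addr0// => j ji.
  case: eqP => [eij|]; last by rewrite mulr0.
  have : (i != j)%N by apply: contraNneq ji => ij; apply/eqP/val_inj.
  rewrite neq_ltn => /orP[h|h].
    by have := @grid_lt i j; rewrite h -ltnS ltn_ord eij ltxx => /(_ isT).
  by have := @grid_lt j i; rewrite h iN eij ltxx => /(_ isT).
apply: L1_sum => i; apply: L1_mulb; first by apply: iX; rewrite -ltnS.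
exact: measurable_fun_eqr.
Qed.

Lemma L1_game_payoff P R t tau sigma :
  (forall i, (i <= N.+1)%N -> L1 mu (P (ts i))) ->
  (forall i, (i <= N.+1)%N -> L1 mu (R (ts i))) ->
  bermudan_time F N ts T t tau -> bermudan_time F N ts T t sigma ->
  L1 mu (game_payoff P R tau sigma).
Proof.
move=> iP iR bt bs.
have mt := stopping_measurable (bermudan_grid_valued bt) (bermudan_stopping bt).
have ms := stopping_measurable (bermudan_grid_valued bs) (bermudan_stopping bs).
apply: L1D; apply: L1_mulb.
- exact: L1_stopped (bermudan_grid_valued bt) mt.
- exact: measurable_fun_ler.
- exact: L1_stopped (bermudan_grid_valued bs) ms.
- exact: measurable_fun_ltr.
Qed.

(** The first date, from t_k on, at which E_i holds (T if there is none).
Built backwards: at t_k, stop on E_k and otherwise follow the time already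
built from t_{k+1} on. *)
Lemma first_entry k (E : nat -> set Omega) : (k <= N.+1)%N ->
  (forall i, (k <= i <= N)%N -> F (ts i) (E i)) ->
  exists2 tau, bermudan_time F N ts T (ts k) tau &
    forall w i, (k <= i <= N)%N ->
      (tau w = ts i -> E i w) /\ (ts i < tau w -> ~ E i w).
Proof.
have [n] := ubnP (N.+1 - k)%N; elim: n k => // n ih k kn kN FE.
move: (kN); rewrite leq_eqVlt => /predU1P[kE|{}kN].
  exists (fun=> T).
    split => [|w]; first exact: stopping_cst.
    by rewrite kE grid_last lexx; split => //; right.
  by move=> w i; rewrite kE => /andP[/leq_trans h /h]; rewrite ltnn.
have kN1 : (k <= N.+1)%N by exact: ltnW.
have kn1 : (N.+1 - k.+1 < n)%N by lia.
have [|tau bt ht] := ih k.+1 kn1 kN.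
  by move=> i /andP[ki iN]; apply: FE; rewrite iN ltnW.
have Ek : F (ts k) (E k) by apply: FE; rewrite leqnn.
exists (fun w => if w \in E k then ts k else tau w).
  split => [s s0|w].
    have [sF _ _] := F_filtration.
    have [ks|ks] := leP (ts k) s.
      rewrite (_ : [set w | _] = E k `|` [set w | tau w <= s]).
        apply: (salgebra_setU (sF _ s0)); last exact: (bermudan_stopping bt).
        exact: filtration_homo (grid_ge0 kN1) ks _ Ek.
      apply/seteqP; split => w /=.
        by case: ifPn => [/set_mem ? _|_ ?]; [left|right].
      by move=> [Ew|tw]; [rewrite (mem_set Ew)|case: ifPn].
    rewrite (_ : [set w | _] = set0); first exact: salgebra_set0 (sF _ s0).
    apply/seteqP; split => // w /=; apply/negP; rewrite -ltNge.
    case: ifPn => // _; apply: lt_le_trans ks _.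
    apply: le_trans (bermudan_ge w bt); apply: grid_le; lia.
  case: ifPn => _.
    by rewrite lexx grid_leT//; split => //; left; exists k.
  have kk : ts k <= ts k.+1 by apply: grid_le; lia.
  exact: (bermudan_le kk bt).2.
move=> w i /andP[]; rewrite leq_eqVlt => /predU1P[<- _|ki iN].
  case: ifPn => [/set_mem Ew|/negP nE]; first by rewrite ltxx; split.
  split => [tk|_ Ew]; last exact/nE/mem_set.
  have := bermudan_ge w bt; rewrite tk leNgt grid_lt//; lia.
case: ifPn => [Ew|_]; last by apply: ht; rewrite ki.
have kit : ts k < ts i by apply: grid_lt; lia.
split => [h|]; first by move: kit; rewrite h ltxx.
by rewrite ltNge (ltW kit).
Qed.

(** Optional stopping, with an error.  On an event B of F_{t_i} inside
{rho >= t_i}, the part where rho = t_i is compared with Y directly; the part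
where rho > t_i is again in F_{t_i}, so that C_i may be replaced there by
U_{i+1}, and that part lies inside {rho >= t_{i+1}}.  Each date costs at most
one eps. *)
Lemma stopped_inequality k (rho : Omega -> K) (U C : nat -> Omega -> K) Y eps :
  stopping_time F rho -> grid_valued rho -> (k <= N.+1)%N ->
  (forall i, (k <= i <= N.+1)%N -> L1 mu (U i)) ->
  (forall i, (k <= i <= N)%N -> L1 mu (C i)) ->
  L1 mu Y -> L1 mu eps -> (forall w, 0 <= eps w) ->
  (forall i B, (k <= i <= N)%N -> F (ts i) B ->
    \int[mu]_(w in B) C i w = \int[mu]_(w in B) U i.+1 w) ->
  (forall i, (k <= i <= N)%N ->
    {ae mu, forall w, rho w = ts i -> U i w <= Y w + eps w}) ->
  (forall i, (k <= i <= N)%N ->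
    {ae mu, forall w, ts i < rho w -> U i w <= C i w + eps w}) ->
  {ae mu, forall w, rho w = T -> U N.+1 w <= Y w} ->
  forall B, F (ts k) B -> (forall w, B w -> ts k <= rho w) ->
  \int[mu]_(w in B) U k w <=
  \int[mu]_(w in B) Y w + (N.+1 - k)%:R * \int[mu]_(w in B) eps w.
Proof.
move=> srho grho kN iU iC iY ieps eps0 CU stop cont last.
suff H n i : (k <= i <= N.+1)%N -> (N.+1 - i)%N = n ->
    forall B, F (ts i) B -> (forall w, B w -> ts i <= rho w) ->
    \int[mu]_(w in B) U i w <=
    \int[mu]_(w in B) Y w + n%:R * \int[mu]_(w in B) eps w.
  by apply: H => //; rewrite leqnn.
elim: n i => [|n ih] i kiN Ni B FB rhoB; have /andP[ki iN1] := kiN.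
  have iE : i = N.+1 by lia.
  rewrite mul0r addr0; apply: ae_le_Rintegral => //; last 2 first.
  - exact: iU.
  - apply: filterS last => w h Bw; rewrite iE; apply: h.
    apply/eqP; rewrite eq_le -grid_last -iE rhoB// andbT iE.
    by have [j jN ->] := grho w; apply: grid_le; rewrite jN/=.
  exact: filtration_measurable FB.
have iN : (i <= N)%N by lia.
have kiN' : (k <= i <= N)%N by rewrite ki.
have mB := filtration_measurable iN1 FB.
pose D := [set w | ts i < rho w].
have FD : F (ts i) D by exact: stopping_gt.
have mD := filtration_measurable iN1 FD.
have FBD := salgebra_setI (filtration_sigma iN1) FB FD.
have mBD : measurable (B `&` D) by exact: measurableI.
have mBC : measurable (B `&` ~` D) by apply: measurableI => //; exact: measurableC.
have intD X : L1 mu X -> _ := Rintegral_split mB mD.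
rewrite (intD _ (iU i kiN)) (intD _ iY) (intD _ ieps).
have iUi := iU i kiN; have iCi := iC i kiN'.
have h1 : \int[mu]_(w in B `&` ~` D) U i w <=
    \int[mu]_(w in B `&` ~` D) Y w + \int[mu]_(w in B `&` ~` D) eps w.
  rewrite -RintegralD//; [|exact: L1S..].
  apply: ae_le_Rintegral => //; [exact: L1D|].
  apply: filterS (stop i kiN') => w h [Bw /negP]; rewrite /D/= -leNgt => ri.
  by apply: h; apply/eqP; rewrite eq_le ri rhoB.
have h2 : \int[mu]_(w in B `&` D) U i w <=
    \int[mu]_(w in B `&` D) U i.+1 w + \int[mu]_(w in B `&` D) eps w.
  rewrite -(CU i)// -RintegralD//; [|exact: L1S..].
  apply: ae_le_Rintegral => //; [exact: L1D|].
  by apply: filterS (cont i kiN') => w h [_ Dw]; exact: h.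
have h3 : \int[mu]_(w in B `&` D) U i.+1 w <=
    \int[mu]_(w in B `&` D) Y w + n%:R * \int[mu]_(w in B `&` D) eps w.
  apply: ih; [lia|lia| |].
    by apply: filtration_grid FBD; lia.
  move=> w [_ Dw]; have [j jN rj] := grho w; rewrite rj; apply: grid_le.
  by rewrite jN andbT; apply: grid_lt_inv => //; rewrite -rj.
have e0 : 0 <= \int[mu]_(w in B `&` ~` D) eps w by exact: Rintegral_ge0.
have := mulr_ge0 (ler0n K n) e0.
rewrite -natr1; lra.
Qed.

End exercise_grid.

(** * Approximate backward recursions and their guarantees *)

Section dynkin_game.
Context (d : measure_display) (Omega : measurableType d) (K : realType).
Variables (mu : probability Omega K) (F : K -> set (set Omega)).
Hypothesis F_filtration : filtration F.
Variables (N : nat) (ts : nat -> K) (T : K).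
Hypothesis ts_grid : time_grid N ts T.
Variables P R : K -> Omega -> K.
Hypothesis P_measurable :
  forall i, (i <= N.+1)%N -> measurable_wrt (F (ts i)) (P (ts i)).
Hypothesis R_measurable :
  forall i, (i <= N.+1)%N -> measurable_wrt (F (ts i)) (R (ts i)).
Hypothesis iP : forall i, (i <= N.+1)%N -> L1 mu (P (ts i)).
Hypothesis iR : forall i, (i <= N.+1)%N -> L1 mu (R (ts i)).
Hypothesis PR : forall i, (i <= N)%N -> {ae mu, forall w, P (ts i) w <= R (ts i) w}.

(** One random variable eps serves all dates: it will be a function of a maximum
over all of them. *)
Definition approx_recursion k (U C : nat -> Omega -> K) (eps : Omega -> K) : Prop :=
  [/\ forall i, (k <= i <= N.+1)%N -> L1 mu (U i),
      forall i, (k <= i <= N)%N -> is_cond_exp mu (F (ts i)) (U i.+1) (C i),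
      forall i, (k <= i <= N)%N -> {ae mu, forall w,
        `|U i w - clamp (P (ts i) w) (R (ts i) w) (C i w)| <= eps w},
      {ae mu, forall w, U N.+1 w = P T w} &
      L1 mu eps /\ forall w, 0 <= eps w].

Lemma game_payoff_le tau sigma w : tau w <= sigma w ->
  game_payoff P R tau sigma w = P (tau w) w.
Proof. by move=> h; rewrite /game_payoff h ltNge h mulr1 mulr0 addr0. Qed.

Lemma game_payoff_lt tau sigma w : sigma w < tau w ->
  game_payoff P R tau sigma w = R (sigma w) w.
Proof. by move=> h; rewrite /game_payoff leNgt h mulr1 mulr0 add0r. Qed.

Section guarantees.
Variables (k : nat) (U C : nat -> Omega -> K) (eps : Omega -> K).
Hypotheses (kN : (k <= N.+1)%N) (UC : approx_recursion k U C eps).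

Let iU i : (k <= i <= N.+1)%N -> L1 mu (U i).
Proof. by case: UC => + _ _ _ _; apply. Qed.

Let condC i : (k <= i <= N)%N -> is_cond_exp mu (F (ts i)) (U i.+1) (C i).
Proof. by case: UC => _ + _ _ _; apply. Qed.

Let iC i : (k <= i <= N)%N -> L1 mu (C i).
Proof. by move=> /condC[]. Qed.

Let intC i B : (k <= i <= N)%N -> F (ts i) B ->
  \int[mu]_(w in B) C i w = \int[mu]_(w in B) U i.+1 w.
Proof. by move=> /condC; exact: cond_exp_Rintegral. Qed.

Let near_clamp i : (k <= i <= N)%N -> {ae mu, forall w,
  P (ts i) w <= R (ts i) w /\
  `|U i w - clamp (P (ts i) w) (R (ts i) w) (C i w)| <= eps w}.
Proof.
move=> kiN; have iN : (i <= N)%N by lia.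
by case: UC => _ _ /(_ i kiN) h _ _; apply: filterS2 (PR iN) h.
Qed.

Let lastU : {ae mu, forall w, U N.+1 w = P T w}. Proof. by case: UC. Qed.
Let ieps : L1 mu eps. Proof. by case: UC => _ _ _ _ []. Qed.
Let eps_ge0 w : 0 <= eps w. Proof. by case: UC => _ _ _ _ []. Qed.

Let payoff_last tau sigma w : bermudan_time F N ts T (ts k) tau ->
  bermudan_time F N ts T (ts k) sigma -> Num.min (tau w) (sigma w) = T ->
  game_payoff P R tau sigma w = P T w.
Proof.
move=> bt bs.
have [_ /(_ w)[_ /andP[_ tT]]] := bt; have [_ /(_ w)[_ /andP[_ sT]]] := bs.
have [ts_le|ts_lt] := leP (tau w) (sigma w) => e; first by rewrite game_payoff_le// e.
by move: ts_lt; rewrite e ltNge tT.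
Qed.

(** The holder stops the first time that C_i <= P_i.  Before that time the
clamp is at most C_i; at that time it is P_i; and it never exceeds R_i, which
is what a seller stopping strictly earlier pays. *)
Lemma buyer_guarantee : exists2 tau, bermudan_time F N ts T (ts k) tau &
  forall sigma, bermudan_time F N ts T (ts k) sigma -> forall B, F (ts k) B ->
    \int[mu]_(w in B) U k w <=
    \int[mu]_(w in B) game_payoff P R tau sigma w +
    (N.+1 - k)%:R * \int[mu]_(w in B) eps w.
Proof.
have [|tau bt ht] := @first_entry _ _ _ _ F_filtration _ _ _ ts_grid k
  (fun i => [set w | C i w <= P (ts i) w]) kN.
  move=> i kiN; have iN : (i <= N.+1)%N by lia.
  have sF := filtration_sigma F_filtration ts_grid iN; have [mC _ _] := condC kiN.
  have := salgebra_setC sF (sub_sigma_algebra_ltr sF (P_measurable iN) mC).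
  by congr (F _ _); apply/seteqP; split => w /=; rewrite leNgt => /negP.
exists tau => // sigma bs B FB.
have gt := bermudan_grid_valued ts_grid bt.
have gs := bermudan_grid_valued ts_grid bs.
apply: (@stopped_inequality _ _ _ _ _ F_filtration _ _ _ ts_grid k
  (fun w => Num.min (tau w) (sigma w)) U C) => //.
- by apply: (stopping_min F_filtration);
    [exact: bermudan_stopping bt|exact: bermudan_stopping bs].
- exact: grid_valued_min.
- exact: (L1_game_payoff F_filtration ts_grid iP iR bt bs).
- move=> i kiN; apply: filterS (near_clamp kiN) => w [pr].
  rewrite ler_norml /clamp => /andP[_ Ule].
  have [h1 h2] := ht w i kiN.
  have [le_ts|lt_st] := leP (tau w) (sigma w) => e.
    rewrite game_payoff_le// e; have {h1} /= cp := h1 e.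
    by move: Ule; rewrite max_l; [lra|rewrite ge_min cp orbT].
  rewrite game_payoff_lt// e.
  have : Num.max (P (ts i) w) (Num.min (R (ts i) w) (C i w)) <= R (ts i) w.
    by rewrite ge_max pr ge_min lexx.
  lra.
- move=> i kiN; apply: filterS (near_clamp kiN) => w [pr].
  rewrite ler_norml /clamp lt_min => /andP[_ Ule] /andP[ti _].
  have [_ /(_ ti)/negP] := ht w i kiN; rewrite -ltNge => pc.
  have : Num.max (P (ts i) w) (Num.min (R (ts i) w) (C i w)) <= C i w.
    by rewrite ge_max (ltW pc) ge_min lexx orbT.
  lra.
- by apply: filterS lastU => w -> /(payoff_last bt bs) ->.
- by move=> w _; rewrite le_min (bermudan_ge w bt) (bermudan_ge w bs).
Qed.

(** The mirror image, obtained from the same stopped inequality for - U, - C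
and minus the payoff; the seller stops the first time that R_i <= C_i. *)
Lemma seller_guarantee : exists2 sigma, bermudan_time F N ts T (ts k) sigma &
  forall tau, bermudan_time F N ts T (ts k) tau -> forall B, F (ts k) B ->
    \int[mu]_(w in B) game_payoff P R tau sigma w <=
    \int[mu]_(w in B) U k w + (N.+1 - k)%:R * \int[mu]_(w in B) eps w.
Proof.
have [|sigma bs hs] := @first_entry _ _ _ _ F_filtration _ _ _ ts_grid k
  (fun i => [set w | R (ts i) w <= C i w]) kN.
  move=> i kiN; have iN : (i <= N.+1)%N by lia.
  have sF := filtration_sigma F_filtration ts_grid iN; have [mC _ _] := condC kiN.
  have := salgebra_setC sF (sub_sigma_algebra_ltr sF mC (R_measurable iN)).
  by congr (F _ _); apply/seteqP; split => w /=; rewrite leNgt => /negP.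
exists sigma => // tau bt B FB.
have gt := bermudan_grid_valued ts_grid bt.
have gs := bermudan_grid_valued ts_grid bs.
have ipay := L1_game_payoff F_filtration ts_grid iP iR bt bs.
have mB := filtration_measurable F_filtration ts_grid kN FB.
suff : \int[mu]_(w in B) (- U k w) <=
    \int[mu]_(w in B) (- game_payoff P R tau sigma w) +
    (N.+1 - k)%:R * \int[mu]_(w in B) eps w.
  rewrite !Rintegral_N//; last by apply: iU; rewrite leqnn.
  lra.
apply: (@stopped_inequality _ _ _ _ _ F_filtration _ _ _ ts_grid k
  (fun w => Num.min (tau w) (sigma w)) (fun i w => - U i w) (fun i w => - C i w)) => //.
- by apply: (stopping_min F_filtration);
    [exact: bermudan_stopping bt|exact: bermudan_stopping bs].
- exact: grid_valued_min.
- by move=> i /iU; exact: L1_N.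
- by move=> i /iC; exact: L1_N.
- exact: L1_N.
- move=> i D kiN FD; have iN : (i <= N.+1)%N by lia.
  have mD := filtration_measurable F_filtration ts_grid iN FD.
  rewrite !Rintegral_N ?(intC kiN)//; [|exact: iC].
  by apply: iU; lia.
- move=> i kiN; apply: filterS (near_clamp kiN) => w [pr].
  rewrite ler_norml /clamp => /andP[Uge _].
  have [h1 h2] := hs w i kiN.
  have [le_ts|lt_st] := leP (tau w) (sigma w) => e.
    rewrite game_payoff_le// e.
    have : P (ts i) w <= Num.max (P (ts i) w) (Num.min (R (ts i) w) (C i w)).
      by rewrite le_max lexx.
    lra.
  rewrite game_payoff_lt// e; have {h1} /= rc := h1 e.
  by move: Uge; rewrite (min_l rc) (max_r pr); lra.
- move=> i kiN; apply: filterS (near_clamp kiN) => w [pr].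
  rewrite ler_norml /clamp lt_min => /andP[Uge _] /andP[_ si].
  have [_ /(_ si)/negP] := hs w i kiN; rewrite -ltNge => cr.
  have : C i w <= Num.max (P (ts i) w) (Num.min (R (ts i) w) (C i w)).
    by rewrite le_max (min_r (ltW cr)) lexx orbT.
  lra.
- by apply: filterS lastU => w -> /(payoff_last bt bs) ->.
- by move=> w _; rewrite le_min (bermudan_ge w bt) (bermudan_ge w bs).
Qed.

End guarantees.

(** Indexed by the number m of dates left, so that the recursion is structural:
the value at t_i is [dynkin_value (N.+1 - i)].  The conditional expectation is
chosen among its versions. *)
Fixpoint dynkin_value (m : nat) : Omega -> K :=
  if m is n.+1 then
    fun w => clamp (P (ts (N - n)%N) w) (R (ts (N - n)%N) w)
      (xget (fun=> 0) [set Y | is_cond_exp mu (F (ts (N - n)%N)) (dynkin_value n) Y] w)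
  else P T.

Lemma exact_recursion : exists U C, approx_recursion 0 U C (fun=> 0).
Proof.
pose U i := dynkin_value (N.+1 - i)%N.
pose C i := xget (fun=> 0) [set Y | is_cond_exp mu (F (ts i)) (U i.+1) Y].
have UE i : (i <= N)%N -> U i = fun w => clamp (P (ts i) w) (R (ts i) w) (C i w).
  by move=> iN; rewrite /C /U subSS (subSn iN)/= (subKn iN).
have CP i : (i <= N)%N -> L1 mu (U i.+1) -> is_cond_exp mu (F (ts i)) (U i.+1) (C i).
  move=> iN iU; have iN1 : (i <= N.+1)%N by lia.
  have [Y hY] := cond_exp_exists (filtration_sigma F_filtration ts_grid iN1)
    (filtration_measurable F_filtration ts_grid iN1) iU.
  exact: (xgetPex (fun=> 0) (ex_intro _ Y hY)).
have iU n i : (N.+1 - i)%N = n -> (i <= N.+1)%N -> L1 mu (U i).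
  elim: n i => [|n ih] i ni iN.
    have -> : i = N.+1 by lia.
    by rewrite /U subnn /= -(grid_last ts_grid); exact: iP.
  have iN' : (i <= N)%N by lia.
  have iU1 : L1 mu (U i.+1) by apply: ih; lia.
  have [_ iC _] := CP i iN' iU1.
  rewrite UE//; apply: L1_max; first exact: iP.
  by apply: L1_min => //; exact: iR.
exists U, C; split.
- by move=> i /andP[_ iN]; exact: iU.
- by move=> i /andP[_ iN]; apply: CP => //; exact: iU.
- by move=> i /andP[_ iN]; apply: aeW => w; rewrite UE// subrr normr0.
- by apply: aeW => w; rewrite /U subnn.
- by split => //; exact: L1_cst.
Qed.

End dynkin_game.

(** * The value of the game *)

Section value_of_the_game.
Context (d : measure_display) (Omega : measurableType d) (K : realType).
Variables (mu : probability Omega K) (F : K -> set (set Omega)).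
Hypothesis F_filtration : filtration F.
Variables (N : nat) (ts : nat -> K) (T : K).
Hypothesis ts_grid : time_grid N ts T.

(** Between the date before t and t_k nothing can be exercised, so that the
stopping times available from t and from t_k are the same. *)
Definition next_date (t : K) (k : nat) : Prop :=
  [/\ (k <= N.+1)%N, t <= ts k & forall i, (i < k)%N -> ts i < t].

Lemma next_date_exists t : t <= T -> exists k, next_date t k.
Proof.
move=> tT.
have ex : exists k, t <= ts k by exists N.+1; rewrite (grid_last ts_grid).
exists (ex_minn ex); case: ex_minnP => k tk kmin; split => //.
  by apply: kmin; rewrite (grid_last ts_grid).
by move=> i ik; rewrite ltNge; apply/negP => /kmin; rewrite leqNgt ik.
Qed.

Lemma bermudan_next t k tau : next_date t k ->
  bermudan_time F N ts T t tau -> bermudan_time F N ts T (ts k) tau.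
Proof.
move=> [kN tk klt] bt; have [st ht] := bt; split => // w.
have [h1 /andP[h2 h3]] := ht w; split => //; rewrite h3 andbT.
have [j jN tj] := bermudan_grid_valued ts_grid bt w.
rewrite tj in h2 *; apply: (grid_le ts_grid); rewrite jN andbT leqNgt.
by apply/negP => /klt; rewrite ltNge h2.
Qed.

Lemma bermudan_cst t i : (i <= N.+1)%N -> t <= ts i ->
  bermudan_time F N ts T t (fun=> ts i).
Proof.
move=> iN ti; split => [|w]; first exact: (stopping_cst F_filtration).
rewrite ti (grid_leT ts_grid iN); split => //.
move: iN; rewrite leq_eqVlt => /predU1P[->|iN]; first by right; exact: (grid_last ts_grid).
by left; exists i.
Qed.

Variables P R : K -> Omega -> K.
Hypothesis P_measurable :
  forall i, (i <= N.+1)%N -> measurable_wrt (F (ts i)) (P (ts i)).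
Hypothesis R_measurable :
  forall i, (i <= N.+1)%N -> measurable_wrt (F (ts i)) (R (ts i)).
Hypothesis iP : forall i, (i <= N.+1)%N -> L1 mu (P (ts i)).
Hypothesis iR : forall i, (i <= N.+1)%N -> L1 mu (R (ts i)).
Hypothesis PR : forall i, (i <= N)%N -> {ae mu, forall w, P (ts i) w <= R (ts i) w}.
Variable V : K -> Omega -> K.
Hypothesis V_value : is_game_value mu F N ts T P R V.
Variables (t : K) (k : nat).
Hypotheses (t_in : 0 <= t <= T) (tk : next_date t k).

Let t_ge0 : 0 <= t. Proof. by case/andP: t_in. Qed.
Let sF : sigma_algebra setT (F t). Proof. by case: F_filtration => h _ _; exact: h. Qed.
Let Fm : F t `<=` measurable. Proof. by case: F_filtration => _ h _; exact: h. Qed.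
Let kN : (k <= N.+1)%N. Proof. by case: tk. Qed.
Let le_tk : t <= ts k. Proof. by case: tk. Qed.
Let Fk : F t `<=` F (ts k). Proof. by apply: (filtration_homo F_filtration). Qed.

(** At a saddle point the family of conditional payoffs of tau0 has a least
element Z, so its essential infimum exists and is Z; for any other tau the
essential infimum is at most the conditional payoff against sigma0, which is
at most Z. *)
Lemma saddle_point_value tau0 sigma0 Z :
  bermudan_time F N ts T t tau0 -> bermudan_time F N ts T t sigma0 ->
  (forall tau B, bermudan_time F N ts T t tau -> F t B ->
    \int[mu]_(w in B) game_payoff P R tau sigma0 w <=
    \int[mu]_(w in B) game_payoff P R tau0 sigma0 w) ->
  (forall sigma B, bermudan_time F N ts T t sigma -> F t B ->
    \int[mu]_(w in B) game_payoff P R tau0 sigma0 w <=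
    \int[mu]_(w in B) game_payoff P R tau0 sigma w) ->
  is_cond_exp mu (F t) (game_payoff P R tau0 sigma0) Z ->
  {ae mu, forall w, V t w = Z w}.
Proof.
move=> bt bs maxt mins cZ; have [mZ iZ _] := cZ.
have mZT := measurable_wrt_measurable sF Fm mZ.
have [mV geV leV] := V_value t_in.
have le_cond tau sigma tau' sigma' Y Y' :
    is_cond_exp mu (F t) (game_payoff P R tau sigma) Y ->
    is_cond_exp mu (F t) (game_payoff P R tau' sigma') Y' ->
    (forall B, F t B -> \int[mu]_(w in B) game_payoff P R tau sigma w <=
       \int[mu]_(w in B) game_payoff P R tau' sigma' w) ->
    {ae mu, forall w, Y w <= Y' w}.
  move=> cY cY' h; have [mY iY _] := cY; have [mY' iY' _] := cY'.
  apply: (ae_le_sub_sigma_algebra sF Fm mY mY' iY iY') => B FB.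
  by rewrite (cond_exp_Rintegral cY FB) (cond_exp_Rintegral cY' FB) h.
have ZV : {ae mu, forall w, Z w <= V t w}.
  apply: geV; exists tau0 => //; split => //.
    move=> Y [sigma bsig cY]; apply: le_cond cZ cY _ => // B FB; exact: mins.
  by move=> Z' _; apply; exists sigma0.
have VZ : {ae mu, forall w, V t w <= Z w}.
  apply: leV => // Y [tau btau [_ leY _]].
  have [Z1 cZ1] := cond_exp_exists sF Fm (L1_game_payoff F_filtration ts_grid iP iR btau bs).
  have Y1 : {ae mu, forall w, Y w <= Z1 w} by apply: leY; exists sigma0.
  have Z1Z : {ae mu, forall w, Z1 w <= Z w}.
    by apply: le_cond cZ1 cZ _ => // B FB; exact: maxt.
  by apply: filterS2 Y1 Z1Z => w; exact: le_trans.
by apply: filterS2 ZV VZ => w h1 h2; apply/eqP; rewrite eq_le h1 h2.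
Qed.

(** With (tau0, sigma0) a saddle point from the exact recursion and (tau, sigma)
the strategies of the approximate one, for each event of F_t:
U - n eps <= payoff (tau, sigma0) <= payoff (tau0, sigma0) <= payoff (tau0, sigma)
<= U + n eps in integral, with n = N.+1 - k. *)
Lemma approx_recursion_value U C eps X E :
  approx_recursion mu F N ts T P R k U C eps ->
  is_cond_exp mu (F t) (U k) X -> is_cond_exp mu (F t) eps E ->
  {ae mu, forall w, `|X w - V t w| <= (N.+1 - k)%:R * E w}.
Proof.
move=> UC cX cE.
have [tau bt gt] := buyer_guarantee F_filtration ts_grid P_measurable iP iR PR kN UC.
have [sigma bs gs] := seller_guarantee F_filtration ts_grid R_measurable iP iR PR kN UC.
have [U0 [C0 exact0]] := exact_recursion F_filtration ts_grid iP iR.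
have {}exact0 : approx_recursion mu F N ts T P R k U0 C0 (fun=> 0).
  case: exact0 => h1 h2 h3 h4 h5; split => //.
  - by move=> i /andP[_ h]; exact: h1.
  - by move=> i /andP[_ h]; exact: h2.
  - by move=> i /andP[_ h]; exact: h3.
have [tau0 bt0 gt0] :=
  buyer_guarantee F_filtration ts_grid P_measurable iP iR PR kN exact0.
have [sigma0 bs0 gs0] :=
  seller_guarantee F_filtration ts_grid R_measurable iP iR PR kN exact0.
have int0 B : F t B -> (N.+1 - k)%:R * \int[mu]_(w in B) (0 : K) = 0 :> K.
  by move=> FB; rewrite Rintegral_cst ?mul0r ?mulr0//; exact: Fm.
have {gt0} gt0 sig B : bermudan_time F N ts T t sig -> F t B ->
    \int[mu]_(w in B) U0 k w <= \int[mu]_(w in B) game_payoff P R tau0 sig w.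
  move=> /(bermudan_next tk) b FB.
  by have := gt0 _ b _ (Fk FB); rewrite int0// addr0.
have {gs0} gs0 ta B : bermudan_time F N ts T t ta -> F t B ->
    \int[mu]_(w in B) game_payoff P R ta sigma0 w <= \int[mu]_(w in B) U0 k w.
  move=> /(bermudan_next tk) b FB.
  by have := gs0 _ b _ (Fk FB); rewrite int0// addr0.
have bt' := bermudan_le le_tk bt; have bs' := bermudan_le le_tk bs.
have bt0' := bermudan_le le_tk bt0; have bs0' := bermudan_le le_tk bs0.
have [Z cZ] := cond_exp_exists sF Fm (L1_game_payoff F_filtration ts_grid iP iR bt0' bs0').
have VZ : {ae mu, forall w, V t w = Z w}.
  apply: (saddle_point_value bt0' bs0') cZ => [ta B b FB|si B b FB].
    exact: le_trans (gs0 _ _ b FB) (gt0 _ _ bs0' FB).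
  exact: le_trans (gs0 _ _ bt0' FB) (gt0 _ _ b FB).
have [mX iX _] := cX; have [mZ iZ _] := cZ; have [mE iE _] := cE.
have inE : L1 mu (fun w => (N.+1 - k)%:R * E w) by exact: L1Z.
have mnE : measurable_wrt (F t) (fun w => (N.+1 - k)%:R * E w).
  by apply: measurable_funM.
have intE B : F t B -> \int[mu]_(w in B) ((N.+1 - k)%:R * E w) =
    (N.+1 - k)%:R * \int[mu]_(w in B) eps w.
  move=> FB; have mB := Fm FB; rewrite RintegralZl//; last exact: L1S.
  by rewrite (cond_exp_Rintegral cE FB).
have lo : {ae mu, forall w, X w - (N.+1 - k)%:R * E w <= Z w}.
  apply: (ae_le_sub_sigma_algebra sF Fm _ mZ _ iZ); first exact: measurable_funB.
    exact: L1B.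
  move=> B FB; have mB := Fm FB; rewrite RintegralB//; [|exact: L1S..].
  rewrite intE// (cond_exp_Rintegral cX FB) (cond_exp_Rintegral cZ FB).
  have h1 := gt _ bs0 _ (Fk FB).
  have h2 := gs0 _ _ bt' FB; have h3 := gt0 _ _ bs0' FB; lra.
have hi : {ae mu, forall w, Z w <= X w + (N.+1 - k)%:R * E w}.
  apply: (ae_le_sub_sigma_algebra sF Fm mZ _ iZ); first exact: measurable_funD.
    exact: L1D.
  move=> B FB; have mB := Fm FB; rewrite RintegralD//; [|exact: L1S..].
  rewrite intE// (cond_exp_Rintegral cX FB) (cond_exp_Rintegral cZ FB).
  have h1 := gs _ bt0 _ (Fk FB).
  have h2 := gs0 _ _ bt0' FB; have h3 := gt0 _ _ bs' FB; lra.
apply: filterS3 VZ lo hi => w -> h1 h2.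
by rewrite ler_norml; apply/andP; split; lra.
Qed.

End value_of_the_game.

(** * The regularised value as an approximate recursion *)

Section regularised_game.
Context (d : measure_display) (Omega : measurableType d) (K : realType).
Variables (mu : probability Omega K) (F : K -> set (set Omega)).
Hypotheses (F_filtration : filtration F) (F_usual : usual_conditions mu F).
Variables (N : nat) (ts : nat -> K) (T : K).
Hypothesis ts_grid : time_grid N ts T.

(** Negligible sets belong to F_0, hence to every F_s. *)
Lemma ae_eq_measurable_wrt s (X Y : Omega -> K) : 0 <= s -> measurable_wrt (F s) X ->
  {ae mu, forall w, X w = Y w} -> measurable_wrt (F s) Y.
Proof.
move=> s0; have [sF _ Fh] := F_filtration; have sFs := sF _ s0.
move=> /(measurable_wrtP sFs) mX XY; apply/(measurable_wrtP sFs) => A mA.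
have null D : mu.-negligible D -> F s D.
  by move=> nD; apply: (Fh 0 s) => //; have [_ h] := F_usual; exact: h.
pose D := ~` [set w | X w = Y w].
have -> : Y @^-1` A = (X @^-1` A `&` ~` D) `|` (Y @^-1` A `&` D).
  apply/seteqP; split => w /=.
    by have [e|ne] := pselect (X w = Y w); [left; rewrite e; split => //; apply|right].
  by move=> [[XA /contrapT <-]|[]].
have FD : F s D by exact: null.
apply: (salgebra_setU sFs); first exact: salgebra_setI (mX _ mA) (salgebra_setC sFs FD).
by apply: null; apply: negligibleS XY => w [].
Qed.

(** Right continuity of the filtration; times close to t_i suffice because the
filtration increases. *)
Lemma measurable_wrt_right_limit i (X : Omega -> K) : (i <= N)%N ->
  (forall s, ts i < s < ts i.+1 -> measurable_wrt (F s) X) ->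
  measurable_wrt (F (ts i)) X.
Proof.
move=> iN mX; have iN1 : (i <= N.+1)%N by exact: leqW.
have [sF _ Fh] := F_filtration.
have ti0 := grid_ge0 ts_grid iN1.
have step : ts i < ts i.+1 by apply: (grid_lt ts_grid); lia.
apply/(measurable_wrtP (sF _ ti0)) => A mA; have [FE _] := F_usual; rewrite (FE _ ti0) => s /=.
rewrite in_itv/= andbT => its.
pose r := (ts i + Num.min s (ts i.+1)) / 2.
have [ir rs r1] : [/\ ts i < r, r < s & r < ts i.+1].
  by rewrite /r; have [h|h] := leP s (ts i.+1); split; lra.
have r0 : 0 <= r by lra.
apply: (Fh r s r0 (ltW rs)).
have irr : ts i < r < ts i.+1 by rewrite ir r1.
by have /(measurable_wrtP (sF _ r0)) h := mX r irr; exact: h.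
Qed.

Variables P R : K -> Omega -> K.
Hypothesis iP : forall i, (i <= N.+1)%N -> L1 mu (P (ts i)).
Hypothesis iR : forall i, (i <= N.+1)%N -> L1 mu (R (ts i)).
Hypothesis P_ge0 : forall i, (i <= N.+1)%N -> {ae mu, forall w, 0 <= P (ts i) w}.
Hypothesis PR : forall i, (i <= N.+1)%N -> {ae mu, forall w, P (ts i) w <= R (ts i) w}.
Hypothesis R_measurable :
  forall i, (i <= N.+1)%N -> measurable_wrt (F (ts i)) (R (ts i)).
Variable lambda : K.
Hypotheses (lambda_gt0 : 0 < lambda) (lambda_lt1 : lambda < 1).
Variables Vl Ml : K -> Omega -> K.
Hypothesis Vl_value : is_regularised_value mu F N ts T lambda P R Vl Ml.

(** The right limit of the regularised value at t_i, but written with the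
values at t_i and t_{i+1} only: integrability and the conditional expectation
property are then immediate. *)
Definition continuation i w : K := Vl (ts i.+1) w - (Ml (ts i.+1) w - Ml (ts i) w).

Let g i w := lambda * Phi ((P (ts i) w - right_lim Vl (ts i) w) / lambda)
           - lambda * Phi ((right_lim Vl (ts i) w - R (ts i) w) / lambda).

Let equation w := forall t, 0 <= t <= T ->
  Vl t w = P T w - (Ml T w - Ml t w) + \sum_(i < N.+1 | t <= ts i < T) g i w.

Let equation_ae : {ae mu, forall w, equation w}.
Proof. by case: Vl_value. Qed.

Let grid_in i : (i <= N.+1)%N -> 0 <= ts i <= T.
Proof. by move=> iN; rewrite (grid_ge0 ts_grid)// (grid_leT ts_grid). Qed.


(** When no date lies in [s, t_k[, the two sums agree, and the value changes
between s and t_k as the martingale does. *)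
Let equation_shift w k s : equation w -> (k <= N.+1)%N -> 0 <= s -> s <= ts k ->
  (forall i, (i < k)%N -> ts i < s) ->
  Vl s w = Vl (ts k) w - (Ml (ts k) w - Ml s w).
Proof.
move=> eqw kN s0 sk klt.
rewrite (eqw s) ?s0 ?(le_trans sk) ?(grid_leT ts_grid)//.
rewrite (eqw (ts k)) ?grid_in//.
rewrite (eq_bigl (fun i : 'I_N.+1 => ts k <= ts i < T)); first by lra.
move=> i; congr (_ && _); have [ik|ki] := ltnP i k.
  rewrite leNgt (klt _ ik)/=; apply/esym/negbTE; rewrite -ltNge.
  by apply: (grid_lt ts_grid); rewrite ik.
have h : ts k <= ts i by apply: (grid_le ts_grid); rewrite ki ltnW.
by rewrite h (le_trans sk h).
Qed.

Lemma regularised_value_martingale k t : next_date N ts t k -> 0 <= t ->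
  {ae mu, forall w, Vl t w = Vl (ts k) w - (Ml (ts k) w - Ml t w)}.
Proof.
move=> [kN tk klt] t0; apply: filterS equation_ae => w eqw.
exact: equation_shift.
Qed.

(** To the right of t_i the value is a constant plus the martingale, whose
paths are right continuous. *)
Lemma right_lim_continuation w i : equation w -> cadlag_path T Ml w -> (i <= N)%N ->
  right_lim Vl (ts i) w = continuation i w.
Proof.
move=> eqw [cad _] iN; have iN1 : (i <= N.+1)%N by exact: leqW.
have ti0 := grid_ge0 ts_grid iN1.
have step : ts i < ts i.+1 by apply: (grid_lt ts_grid); lia.
rewrite /right_lim; apply: cvg_lim => //.
have -> : continuation i w = Vl (ts i.+1) w - Ml (ts i.+1) w + Ml (ts i) w.
  by rewrite /continuation; ring.
have lim_shift : (Vl (ts i.+1) w - Ml (ts i.+1) w + Ml s w) @[s --> (ts i)^'+] -->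
    Vl (ts i.+1) w - Ml (ts i.+1) w + Ml (ts i) w.
  apply: cvgD; first exact: cvg_cst.
  by apply: cad; rewrite ti0/=; exact: (grid_ltT ts_grid).
apply: cvg_trans lim_shift.
apply: near_eq_cvg; near=> s.
have its : ts i < s by near: s; exact: nbhs_right_gt.
have si : s < ts i.+1 by near: s; exact: nbhs_right_lt.
have := @equation_shift w i.+1 s eqw; rewrite ltnS iN => ->//.
- by rewrite /=; lra.
- by rewrite (le_trans ti0)// ltW.
- exact: ltW.
- move=> j; rewrite ltnS => ji; apply: le_lt_trans its.
  by apply: (grid_le ts_grid); rewrite ji.
Unshelve. all: by end_near.
Qed.

Lemma regularised_update i : (i <= N)%N -> {ae mu, forall w,
  Vl (ts i) w = continuation i w +
    (lambda * Phi ((P (ts i) w - continuation i w) / lambda)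
     - lambda * Phi ((continuation i w - R (ts i) w) / lambda))}.
Proof.
move=> iN; have iN1 : (i <= N.+1)%N by exact: leqW.
have [_ _ [[_ _ _ cad] _] _ _] := Vl_value.
apply: filterS2 cad equation_ae => w cadw eqw.
rewrite -(right_lim_continuation eqw cadw iN) -/(g i w).
rewrite (right_lim_continuation eqw cadw iN) /continuation.
rewrite (eqw (ts i)) ?grid_in// (eqw (ts i.+1)) ?grid_in//.
have io : (i < N.+1)%N by [].
rewrite (bigD1 (Ordinal io))/=; last by rewrite lexx (grid_ltT ts_grid).
rewrite (eq_bigl (fun j : 'I_N.+1 => ts i.+1 <= ts j < T)); first by lra.
move=> j; rewrite andbAC; congr (_ && _).
have jN : (j <= N.+1)%N by rewrite leqW// -ltnS.
have [ij|ji] := ltnP i j.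
  rewrite !(grid_le ts_grid) ?ij ?(ltnW ij)//=.
  by apply: contraTneq ij => ->/=; rewrite ltnn.
rewrite [RHS](_ : _ = false); last first.
  by apply/negbTE; rewrite -ltNge; apply: (grid_lt ts_grid); lia.
apply/negbTE; rewrite negb_and negbK.
move: ji; rewrite leq_eqVlt => /predU1P[ji|ji]; first by apply/orP; right; apply/eqP/val_inj.
by rewrite -ltNge (grid_lt ts_grid)// ji.
Qed.

Lemma regularised_last : {ae mu, forall w, Vl T w = P T w}.
Proof.
apply: filterS equation_ae => w eqw; rewrite eqw.
  rewrite subrr subr0 big_pred0 ?addr0// => i.
  by apply/negbTE; rewrite negb_and -!ltNge (grid_ltT ts_grid)// -ltnS.
by have := grid_in (leqnn N.+1); rewrite (grid_last ts_grid).
Qed.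

Lemma regularised_L1 t : 0 <= t <= T -> L1 mu (Vl t).
Proof.
move=> /andP[t0 tT]; have [_ [iV _] _ _ _] := Vl_value; apply: iV.
exists (fun=> t); split => //; last by move=> _; rewrite t0.
exact: (stopping_cst F_filtration).
Qed.

Lemma regularised_martingale_L1 t : 0 <= t <= T -> L1 mu (Ml t).
Proof. by have [_ _ [[_ iM _ _] _] _ _] := Vl_value; exact: iM. Qed.

Lemma continuation_L1 i : (i <= N)%N -> L1 mu (continuation i).
Proof.
move=> iN; apply: L1B; first by apply/regularised_L1/grid_in.
by apply: L1B; apply/regularised_martingale_L1/grid_in => //; exact: leqW.
Qed.

Lemma Rintegral_martingale_shift s t B : 0 <= s -> s <= t -> t <= T -> F s B ->
  \int[mu]_(w in B) (Vl t w - (Ml t w - Ml s w)) = \int[mu]_(w in B) Vl t w.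
Proof.
move=> s0 st tT FB; have [_ Fm _] := F_filtration; have mB := Fm _ s0 _ FB.
have t_in : 0 <= t <= T by rewrite tT (le_trans s0).
have s_in : 0 <= s <= T by rewrite s0 (le_trans st).
have iV := regularised_L1 t_in.
have iMt := regularised_martingale_L1 t_in.
have iMs := regularised_martingale_L1 s_in.
have [_ _ [[_ _ condM _] _] _ _] := Vl_value.
have iD := L1B iMt iMs.
rewrite RintegralB//; [|exact: L1S..].
rewrite RintegralB//; [|exact: L1S..].
by rewrite (cond_exp_Rintegral (condM s t s0 st tT) FB) subrr subr0.
Qed.

Lemma regularised_cond_exp t k : next_date N ts t k -> 0 <= t ->
  is_cond_exp mu (F t) (Vl (ts k)) (Vl t).
Proof.
move=> tk t0; have [kN le_tk _] := tk; have [sF Fm _] := F_filtration.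
have tT : t <= T by rewrite (le_trans le_tk)// (grid_leT ts_grid).
have t_in : 0 <= t <= T by rewrite t0.
have [adV _ _ _ _] := Vl_value.
have iVk := regularised_L1 (grid_in kN).
apply: (is_cond_expP (Fm _ t0)) => //; [exact: adV|exact: regularised_L1|].
move=> B FB; rewrite -(Rintegral_martingale_shift t0 le_tk _ FB) ?(grid_leT ts_grid)//.
apply: ae_eq_Rintegral; [exact: Fm FB|exact: regularised_L1| |].
  by apply: L1B => //; apply: L1B; apply: regularised_martingale_L1 => //; exact: grid_in.
exact: regularised_value_martingale.
Qed.

(** Measurability at t_i is the point: for each s in ]t_i, t_{i+1}[ the
continuation value is almost surely Vl_s - (M_s - M_{t_i}), which is known at
time s, so it is known at t_i by right continuity of the filtration. *)
Lemma continuation_cond_exp i : (i <= N)%N ->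
  is_cond_exp mu (F (ts i)) (Vl (ts i.+1)) (continuation i).
Proof.
move=> iN; have iN1 : (i <= N.+1)%N by exact: leqW.
have [sF Fm Fh] := F_filtration.
have ti0 := grid_ge0 ts_grid iN1.
have [adV _ [[adM _ _ _] _] _ _] := Vl_value.
apply: (is_cond_expP (Fm _ ti0)); last 2 first.
- exact: continuation_L1.
- move=> B FB; apply: Rintegral_martingale_shift => //.
    by apply/ltW/(grid_lt ts_grid); lia.
  exact: (grid_leT ts_grid).
- apply: measurable_wrt_right_limit => // s /andP[its si].
  have s0 : 0 <= s by rewrite (le_trans ti0)// ltW.
  have sT : 0 <= s <= T.
    by rewrite s0 (le_trans (ltW si))// (grid_leT ts_grid).
  apply: (@ae_eq_measurable_wrt _ (fun w => Vl s w - (Ml s w - Ml (ts i) w))) => //.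
    have mMi : measurable_wrt (F s) (Ml (ts i)).
      move=> _ A mA; apply: (sub_sigma_algebra2 (Fh _ _ ti0 (ltW its))).
      exact: (adM (ts i) (grid_in iN1) measurableT A mA).
    apply: measurable_funB; first exact: adV.
    by apply: measurable_funB => //; exact: adM.
  apply: filterS equation_ae => w eqw.
  rewrite (@equation_shift w i.+1 s) ?(ltW si)//; first by rewrite /continuation; lra.
  move=> j; rewrite ltnS => ji; apply: le_lt_trans its.
  by apply: (grid_le ts_grid); rewrite ji.
- exact/regularised_L1/grid_in.
Qed.

Lemma regularised_between i : (i <= N.+1)%N ->
  {ae mu, forall w, P (ts i) w <= Vl (ts i) w <= R (ts i) w}.
Proof.
move=> iN1; move: (iN1); rewrite leq_eqVlt => /predU1P[->|iN].
  apply: filterS2 regularised_last (PR (leqnn _)) => w.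
  by rewrite (grid_last ts_grid) => -> ->; rewrite lexx.
apply: filterS2 (regularised_update iN) (PR iN1) => w -> pr.
exact: regularised_update_bounds.
Qed.

Variable V2R : K -> Omega -> K.
Hypothesis V2R_price : is_bermudan_price mu F N ts T (fun u w => 2 * R u w) V2R.

Lemma R_ge0 i : (i <= N.+1)%N -> {ae mu, forall w, 0 <= R (ts i) w}.
Proof. by move=> iN; apply: filterS2 (P_ge0 iN) (PR iN) => w; exact: le_trans. Qed.

(** Stopping at t_i at once is admissible. *)
Lemma R_le_price i : (i <= N)%N -> {ae mu, forall w, R (ts i) w <= V2R (ts i) w}.
Proof.
move=> iN; have iN1 : (i <= N.+1)%N by exact: leqW.
have [_ geV _] := V2R_price (grid_in iN1).
have i2R : L1 mu (fun w => 2 * R (ts i) w) by apply: L1Z; exact: iR.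
have h : {ae mu, forall w, 2 * R (ts i) w <= V2R (ts i) w}.
  apply: geV; exists (fun=> ts i); first exact: bermudan_cst.
  split => //; apply: measurable_funM => //; exact: R_measurable.
apply: filterS2 (R_ge0 iN1) h => w; lra.
Qed.

(** Stopping at t_{i+1} is admissible for the option, and the value at t_{i+1}
lies below R there. *)
Lemma continuation_le_price i : (i <= N)%N ->
  {ae mu, forall w, continuation i w <= V2R (ts i) w}.
Proof.
move=> iN; have iN1 : (i <= N.+1)%N by exact: leqW.
have [_ geV _] := V2R_price (grid_in iN1).
have sF := filtration_sigma F_filtration ts_grid iN1.
have Fm := filtration_measurable F_filtration ts_grid iN1.
have i2R : L1 mu (fun w => 2 * R (ts i.+1) w) by apply: L1Z; exact: iR.
have [Z cZ] := cond_exp_exists sF Fm i2R.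
have ZV : {ae mu, forall w, Z w <= V2R (ts i) w}.
  apply: geV; exists (fun=> ts i.+1) => //; apply: bermudan_cst => //.
  by apply/ltW/(grid_lt ts_grid); lia.
have cC := continuation_cond_exp iN.
have [mZ iZ _] := cZ; have [mC iC _] := cC.
have CZ : {ae mu, forall w, continuation i w <= Z w}.
  apply: (ae_le_sub_sigma_algebra sF Fm mC mZ iC iZ) => B FB.
  rewrite (cond_exp_Rintegral cC FB) (cond_exp_Rintegral cZ FB).
  apply: ae_le_Rintegral => //; [exact: Fm|exact/regularised_L1/grid_in|].
  apply: filterS2 (@R_ge0 i.+1 iN) (@regularised_between i.+1 iN) => w R0 /andP[_ h] _; lra.
by apply: filterS2 CZ ZV => w; exact: le_trans.
Qed.

Lemma continuation_ge0 i : (i <= N)%N -> {ae mu, forall w, 0 <= continuation i w}.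
Proof.
move=> iN; have iN1 : (i <= N.+1)%N by exact: leqW.
have sF := filtration_sigma F_filtration ts_grid iN1.
have Fm := filtration_measurable F_filtration ts_grid iN1.
have cC := continuation_cond_exp iN; have [mC iC _] := cC.
apply: (@ae_le_sub_sigma_algebra _ _ _ mu _ sF Fm (fun=> 0) _ _ mC _ iC);
  [exact: measurable_cst|exact: L1_cst|].
move=> B FB; rewrite (cond_exp_Rintegral cC FB).
apply: ae_le_Rintegral => //; [exact: Fm|exact: L1_cst|exact/regularised_L1/grid_in|].
by apply: filterS2 (@P_ge0 i.+1 iN) (@regularised_between i.+1 iN) => w p0 /andP[/(le_trans p0)].
Qed.

Variable t : K.

Definition price_bound w : K := Num.max (running_max N ts T V2R t w) 1.

Lemma price_bound_ge1 w : 1 <= price_bound w.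
Proof. by rewrite /price_bound le_max lexx orbT. Qed.

Lemma regularised_near_clamp i : (i <= N)%N -> t <= ts i -> {ae mu, forall w,
  `|Vl (ts i) w - clamp (P (ts i) w) (R (ts i) w) (continuation i w)|
  <= regularisation_rate lambda (price_bound w)}.
Proof.
move=> iN ti; have iN1 : (i <= N.+1)%N by exact: leqW.
have hC : {ae mu, forall w, 0 <= continuation i w <= V2R (ts i) w}.
  by apply: filterS2 (continuation_ge0 iN) (continuation_le_price iN) => w -> ->.
have hPR : {ae mu, forall w, [/\ 0 <= P (ts i) w, P (ts i) w <= R (ts i) w &
    R (ts i) w <= V2R (ts i) w]}.
  by apply: filterS3 (P_ge0 iN1) (PR iN1) (R_le_price iN).
apply: filterS3 (regularised_update iN) hC hPR => w -> /andP[c0 cV] [p0 pr0 rV].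
have VB : V2R (ts i) w <= price_bound w.
  rewrite /price_bound le_max; apply/orP; left.
  rewrite /running_max (bigD1 (Ordinal (iN : (i < N.+1)%N)))/=.
    by rewrite le_max lexx.
  by rewrite ti (grid_ltT ts_grid).
apply: regularised_update_clamp => //.
- exact: price_bound_ge1.
- by rewrite ler_norml; apply/andP; split; lra.
- by rewrite ler_norml; apply/andP; split; lra.
Qed.

Lemma regularised_approx_recursion k : next_date N ts t k ->
  L1 mu (fun w => ln (price_bound w)) ->
  approx_recursion mu F N ts T P R k (fun i => Vl (ts i)) continuation
    (fun w => regularisation_rate lambda (price_bound w)).
Proof.
move=> [kN tk _] iln; split.
- by move=> i /andP[_ iN]; exact/regularised_L1/grid_in.
- by move=> i /andP[_ iN]; exact: continuation_cond_exp.
- move=> i /andP[ki iN]; apply: regularised_near_clamp => //.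
  by rewrite (le_trans tk)// (grid_le ts_grid)// ki leqW.
- by rewrite (grid_last ts_grid); exact: regularised_last.
- split; first by apply: L1Z; apply: L1D => //; exact: L1_cst.
  by move=> w; apply: regularisation_rate_ge0 => //; exact: price_bound_ge1.
Qed.

End regularised_game.

(** * The error bound *)

(** For 0 < t the left-hand side is one less: the maximum in N(t) is the last
index before t, not the first index from t on. *)
Lemma remaining_dates_ge (K : realType) (N : nat) (ts : nat -> K) (t : K) k :
  next_date N ts t k -> time_grid N ts (ts N.+1) ->
  (N.+1 - k <= remaining_dates N ts t)%N.
Proof.
move=> [kN tk _] grid; apply: leq_sub2l; apply/bigmax_leqP => i ti.
rewrite leqNgt; apply/negP => ki; move: ti; rewrite ltNge (le_trans tk)//.
apply: (grid_le grid); rewrite (ltnW ki)/=; exact: ltnW.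
Qed.

Theorem theorem4p1
  (K : realType) (d : measure_display) (Omega : measurableType d)
  (mu : probability Omega K) (F : K -> set (set Omega))
  (F_filtration : filtration F) (F_usual : usual_conditions mu F)
  (T : K) (T_gt0 : 0 < T) (N : nat) (ts : nat -> K)
  (ts_grid : time_grid N ts T)
  (P R : K -> Omega -> K)
  (P_adapted : adapted F T P) (R_adapted : adapted F T R)
  (P_ge0 : forall t, 0 <= t <= T -> {ae mu, forall w, 0 <= P t w})
  (P_lt_R : forall u, exercise_dates N ts u -> {ae mu, forall w, P u w < R u w})
  (R_eq_P : {ae mu, forall w, R T w = P T w})
  (P_int : (\big[maxe/-oo]_(i < N.+2) 'E_mu[P (ts i)] < +oo)%E)
  (R_int : (\big[maxe/-oo]_(i < N.+2) 'E_mu[R (ts i)] < +oo)%E)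
  (V : K -> Omega -> K) (V_value : is_game_value mu F N ts T P R V)
  (V2R : K -> Omega -> K)
  (V2R_price : is_bermudan_price mu F N ts T (fun u w => 2 * R u w) V2R)
  (lambda : K) (lambda_gt0 : 0 < lambda) (lambda_lt1 : lambda < 1)
  (Vl Ml : K -> Omega -> K)
  (Vl_value : is_regularised_value mu F N ts T lambda P R Vl Ml)
  (t : K) (t_in : 0 <= t <= T)
  (L : Omega -> K)
  (L_cond : is_cond_exp mu (F t)
     (fun w => ln (Num.max (running_max N ts T V2R t w) 1)) L) :
  {ae mu, forall w,
    `|Vl t w - V t w| <=
      (remaining_dates N ts t)%:R * (1 - ln (1 - expR (- 1)) + L w)
      * (lambda - lambda * ln lambda)}.
Proof.
have grid_in i : (i <= N.+1)%N -> 0 <= ts i <= T.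
  by move=> iN; rewrite (grid_ge0 ts_grid)// (grid_leT ts_grid).
have P_meas i : (i <= N.+1)%N -> measurable_wrt (F (ts i)) (P (ts i)).
  by move=> iN; exact: (P_adapted _ (grid_in i iN)).
have R_meas i : (i <= N.+1)%N -> measurable_wrt (F (ts i)) (R (ts i)).
  by move=> iN; exact: (R_adapted _ (grid_in i iN)).
have P0 i : (i <= N.+1)%N -> {ae mu, forall w, 0 <= P (ts i) w}.
  by move=> iN; exact: (P_ge0 _ (grid_in i iN)).
have PR i : (i <= N.+1)%N -> {ae mu, forall w, P (ts i) w <= R (ts i) w}.
  rewrite leq_eqVlt => /predU1P[->|iN].
    by apply: filterS R_eq_P => w; rewrite (grid_last ts_grid) => ->.
  by apply: filterS (P_lt_R (ts i) _) => [w /ltW//|]; exists i.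
have L1_of_max (X : K -> Omega -> K) :
    (forall i, (i <= N.+1)%N -> measurable_wrt (F (ts i)) (X (ts i))) ->
    (forall i, (i <= N.+1)%N -> {ae mu, forall w, 0 <= X (ts i) w}) ->
    (\big[maxe/-oo]_(i < N.+2) 'E_mu[X (ts i)] < +oo)%E ->
    forall i, (i <= N.+1)%N -> L1 mu (X (ts i)).
  move=> mX X0 h i iN; apply: L1_of_expectation (X0 i iN) _.
    have sFi := filtration_sigma F_filtration ts_grid iN.
    have Fmi := filtration_measurable F_filtration ts_grid iN.
    exact: (measurable_wrt_measurable sFi Fmi (mX i iN)).
  apply: le_lt_trans h.
  by rewrite (bigD1 (Ordinal (iN : (i < N.+2)%N)))//= le_max lexx.
have iP := L1_of_max P P_meas P0 P_int.
have iR := L1_of_max R R_meas (fun i iN => R_ge0 P0 PR iN) R_int.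
have /andP[t0 tT] := t_in; have [k tk] := next_date_exists ts_grid tT.
have [sF Fm _] := F_filtration.
have mln : measurable_fun setT (fun w => ln (price_bound N ts T V2R t w)).
  apply: measurableT_comp; first exact: measurable_ln.
  apply: measurable_maxr; last exact: measurable_cst.
  apply: measurable_bigmaxr => i _.
  by have [] := V2R_price (ts i) (grid_in i (ltnW (ltn_ord i))).
have iln : L1 mu (fun w => ln (price_bound N ts T V2R t w)).
  apply: L1_of_cond_exp (sF _ t0) mln _ L_cond => w.
  by rewrite ln_ge0// price_bound_ge1.
have UC := regularised_approx_recursion F_filtration F_usual ts_grid iR P0 PR
  R_meas lambda_gt0 lambda_lt1 Vl_value V2R_price tk iln.
have cV := regularised_cond_exp F_filtration ts_grid Vl_value tk t0.
have cE := cond_exp_affine (lambda - lambda * ln lambda) (1 - ln (1 - expR (-1)))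
  (sF _ t0) (Fm _ t0) iln L_cond.
have PR' i : (i <= N)%N -> {ae mu, forall w, P (ts i) w <= R (ts i) w}.
  by move=> iN; apply: PR; exact: leqW.
have bound := approx_recursion_value F_filtration ts_grid P_meas R_meas iP iR PR'
  V_value t_in tk UC cV cE.
have [mL iL _] := L_cond.
have L0 : {ae mu, forall w, 0 <= L w}.
  apply: (@ae_le_sub_sigma_algebra _ _ _ mu _ (sF _ t0) (Fm _ t0) (fun=> 0) _ _ mL _ iL);
    [exact: measurable_cst|exact: L1_cst|].
  move=> B FB; rewrite (cond_exp_Rintegral L_cond FB).
  apply: ae_le_Rintegral => //; [exact: (Fm _ t0)|exact: L1_cst|].
  by apply: aeW => w _; rewrite ln_ge0// price_bound_ge1.
apply: filterS2 L0 bound => w Lw /le_trans; apply.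
rewrite -mulrA [X in _ <= _ * X]mulrC ler_wpM2r//.
  have := regularisation_rate_ge0 lambda_gt0 lambda_lt1 (lexx 1).
  rewrite /regularisation_rate ln1 addr0 => h.
  rewrite mulrDr addr_ge0// mulr_ge0// subr_ge0 -[leRHS]mulr1 ler_pM2l//.
  by rewrite (le_trans (ln_le0 (ltW lambda_lt1))).
by rewrite ler_nat; apply: remaining_dates_ge => //; rewrite (grid_last ts_grid).
Qed.
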